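(* The following conditions for an $\mathfrak{S}_\infty$-central state $\varphi$ on the group $\Gamma\wr\mathfrak{S}_\infty$ are equivalent: (a) $\varphi$ is indecomposable; (b) $\varphi(gg')=\varphi(g)\varphi(g')$ for all $g,g'\in\Gamma\wr\mathfrak{S}_\infty$ with ${\rm supp}(g)\cap{\rm supp}(g')=\emptyset$; (c) $\varphi(g)=\prod_{p\in\mathbb{N}/s}\varphi(s_p\gamma(p))$ for each $g=s\gamma=\prod_{p\in\mathbb{N}/s}s_p\gamma(p)$ with $s\in\mathfrak{S}_\infty$, $\gamma\in\Gamma^\infty_e$.
   Context: $\mathfrak{S}_\infty$ is the (discrete) group of all bijections of $\mathbb{N}=\{1,2,\ldots\}$ moving only finitely many points. $\Gamma$ is a separable topological group with identity $e$; $\Gamma^\infty_e$ is the group of sequences $\gamma=(\gamma_1,\gamma_2,\ldots)$ in $\Gamma$ with only finitely many $\gamma_i\neq e$, with the inductive limit topology of the $\Gamma^n$. $\Gamma\wr\mathfrak{S}_\infty=\Gamma^\infty_e\rtimes\mathfrak{S}_\infty$ carries the product topology; each element is uniquely $s\gamma$ with $s\in\mathfrak{S}_\infty$, $\gamma\in\Gamma^\infty_e$, and $s(\gamma_1,\gamma_2,\ldots)s^{-1}=(\gamma_{s^{-1}(1)},\gamma_{s^{-1}(2)},\ldots)$. A state is a continuous positive definite function $\varphi$ with $\varphi(e)=1$; it is indecomposable if its GNS-representation generates a factor, and $\mathfrak{S}_\infty$-central if $\varphi(gs)=\varphi(sg)$ for all $g\in\Gamma\wr\mathfrak{S}_\infty$,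 $s\in\mathfrak{S}_\infty$. For $g=s\gamma$, ${\rm supp}(g)=\{i:s(i)\ne i\text{ or }\gamma_i\ne e\}$ (finite). $\mathbb{N}/s$ is the set of orbits of $s$ on $\mathbb{N}$; for an orbit $p$, $s_p$ is the permutation equal to $s$ on $p$ and to the identity off $p$, and $\gamma(p)\in\Gamma^\infty_e$ has $k$-th entry $\gamma_k$ if $k\in p$ and $e$ otherwise. The elements $s_p\gamma(p)$ (generalized cycles) commute, all but finitely many equal the identity, and $s\gamma=\prod_p s_p\gamma(p)$. *)

(* Defs.v *)
From HB Require Import structures.
From mathcomp Require Import all_boot all_order all_algebra.
From mathcomp Require Import sesquilinear finmap.
From mathcomp Require Import all_classical all_reals all_analysis.
From mathcomp.real_closed Require Import complex.

Set Implicit Arguments.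
Unset Strict Implicit.
Unset Printing Implicit Defensive.

Import Order.TTheory GRing.Theory Num.Theory.
Import numFieldNormedType.Exports.

Local Open Scope classical_set_scope.
Local Open Scope ring_scope.

HB.mixin Record isTopologicalGroup G & Topological G & Group G := {
  mulg_continuous : continuous (fun x : G * G => (x.1 * x.2)%g) ;
  invg_continuous : continuous (fun x : G => (x^-1)%g)
}.

(** No separation axiom is assumed. *)
#[short(type="topologicalGroupType")]
HB.structure Definition TopologicalGroup :=
  {G of Topological G & Group G & isTopologicalGroup G}.

Definition separable (T : topologicalType) :=
  exists D : set T, countable D /\ dense D.

(** The set of natural numbers is {0, 1, 2, ...} here, in place of
    {1, 2, ...}. *)
Record finperm := Finperm {
  finperm_fun :> {fsfun nat -> nat} ;
  _ : `[< bijective finperm_fun >]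
}.

HB.instance Definition _ := [isSub for finperm_fun].
HB.instance Definition _ := [Choice of finperm by <:].

Lemma finperm_bij (s : finperm) : bijective s.
Proof. by case: s => f /= /asboolP. Qed.

Lemma finpermP (s t : finperm) : s =1 t -> s = t.
Proof. by move=> /fsfunP st; apply/val_inj. Qed.

Lemma finperm1_subproof : `[< bijective ([fsfun] : {fsfun nat -> nat}) >].
Proof. by apply/asboolP; exists id => i; rewrite fsfun0E. Qed.
Definition finperm1 := Finperm finperm1_subproof.

Lemma finperm_mul_subproof (s t : finperm) : `[< bijective (fsfun_comp s t) >].
Proof.
apply/asboolP; apply: (@eq_bij _ _ (s \o t)) => [|i]; last by rewrite fscompE.
exact: bij_comp (finperm_bij s) (finperm_bij t).
Qed.
(** (s t)(i) = s(t(i)) *)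
Definition finperm_mul (s t : finperm) := Finperm (finperm_mul_subproof s t).


Definition finperm_preim (s : finperm) (i : nat) : nat :=
  xget 0%N [set j | s j = i].

Lemma finperm_preimK (s : finperm) : cancel (finperm_preim s) s.
Proof.
move=> i; rewrite /finperm_preim; case: xgetP => // /(_ _)/= ns.
by have [g _ gK] := finperm_bij s; case: (ns (g i)); exact: gK.
Qed.

Lemma finperm_preimVK (s : finperm) : cancel s (finperm_preim s).
Proof. by move=> i; apply: (bij_inj (finperm_bij s)); rewrite finperm_preimK. Qed.

Definition finperm_inv_fun (s : finperm) : {fsfun nat -> nat} :=
  [fsfun i in finsupp s => finperm_preim s i].

Lemma finperm_inv_funE (s : finperm) : finperm_inv_fun s =1 finperm_preim s.
Proof.
move=> i; rewrite fsfunE; case: finsuppP => // /fsfun_dflt si.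
by rewrite -{2}si finperm_preimVK.
Qed.

Lemma finperm_inv_subproof (s : finperm) : `[< bijective (finperm_inv_fun s) >].
Proof.
apply/asboolP; exists s => i; rewrite finperm_inv_funE.
  exact: finperm_preimK.
exact: finperm_preimVK.
Qed.
Definition finperm_inv (s : finperm) := Finperm (finperm_inv_subproof s).

Lemma finperm_mulA : associative finperm_mul.
Proof. by move=> s t u; apply: finpermP => i; rewrite /= !fscompE /= !fscompE. Qed.

Lemma finperm_mul1 : left_id finperm1 finperm_mul.
Proof. by move=> s; apply: finpermP => i; rewrite /= fscompE /= fsfun0E. Qed.

Lemma finperm_mulr1 : right_id finperm1 finperm_mul.
Proof. by move=> s; apply: finpermP => i; rewrite /= fscompE /= fsfun0E. Qed.

Lemma finperm_mulV : left_inverse finperm1 finperm_inv finperm_mul.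
Proof.
move=> s; apply: finpermP => i.
by rewrite /= fscompE /= fsfun0E finperm_inv_funE finperm_preimVK.
Qed.

Lemma finperm_mulrV : right_inverse finperm1 finperm_inv finperm_mul.
Proof.
move=> s; apply: finpermP => i.
by rewrite /= fscompE /= fsfun0E finperm_inv_funE finperm_preimK.
Qed.

HB.instance Definition _ := isGroup.Build finperm
  finperm_mulA finperm_mul1 finperm_mulr1 finperm_mulV finperm_mulrV.

HB.instance Definition _ := hasNbhs.Build finperm principal_filter.
HB.instance Definition _ := Discrete_ofNbhs.Build finperm erefl.

Lemma finperm1E i : (1%g : finperm) i = i.
Proof. exact: fsfun0E. Qed.

Lemma finpermM (s t : finperm) i : (s * t)%g i = s (t i).
Proof. exact: fscompE. Qed.

Lemma finpermKV (s : finperm) : cancel s^-1%g s.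
Proof. by move=> i; rewrite -finpermM mulgV finperm1E. Qed.

Lemma finpermK (s : finperm) : cancel s s^-1%g.
Proof. by move=> i; rewrite -finpermM mulVg finperm1E. Qed.

Definition finseq (G : groupType) := {fsfun nat -> G with 1%g}.

HB.instance Definition _ (G : groupType) := Choice.on (finseq G).

Section FinseqTopology.
Variable G : topologicalGroupType.

(** The inclusion of G^n: complete an n-tuple by the neutral element. *)
Definition finseq_ext n (x : {ptws 'I_n -> G}) : finseq G :=
  [fsfun i in [fset val j | j : 'I_n]%fset => oapp x 1%g (insub i)].

Lemma finseq_extE n (x : {ptws 'I_n -> G}) (i : nat) :
  finseq_ext x i = oapp x 1%g (insub i).
Proof.
rewrite fsfunE; case: ifPn => // /imfsetP ni; case: insubP => //= j _ ji.
by case: ni; exists j.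
Qed.

(** Inductive limit topology: the finest topology making all the inclusions
    of the finite powers (with their product topologies) continuous. *)
Definition finseq_open : set_system (finseq G) :=
  [set U | forall n, open (@finseq_ext n @^-1` U)].

Lemma finseq_openT : finseq_open setT.
Proof. by move=> n; rewrite preimage_setT; exact: openT. Qed.

Lemma finseq_openI : setI_closed finseq_open.
Proof. by move=> U V oU oV n; rewrite preimage_setI; exact: openI. Qed.

Lemma finseq_open_bigU (I : Type) (U : I -> set (finseq G)) :
  (forall i, finseq_open (U i)) -> finseq_open (\bigcup_i U i).
Proof.
move=> oU n; rewrite preimage_bigcup.
by apply: bigcup_open => i _; exact: oU.
Qed.

HB.instance Definition _ := isOpenTopological.Build (finseq G)
  finseq_openT finseq_openI finseq_open_bigU.

End FinseqTopology.

(** The pair (s, a) stands for the product of s by a, in this order. *)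
Definition wreath (G : groupType) : Type := (finperm * finseq G)%type.

HB.instance Definition _ (G : groupType) := Choice.on (wreath G).

Section WreathGroup.
Variable G : groupType.
Implicit Types (s t : finperm) (a b : finseq G) (g h : wreath G).

Definition finseq1 : finseq G := [fsfun with 1%g].

Lemma finseq1E i : finseq1 i = 1%g.
Proof. exact: fsfun0E. Qed.

(** i |-> a_(t i) * b_i, the sequence (t^-1 a t) b *)
Definition finseq_twist_mul a t b : finseq G :=
  [fsfun i in (finperm_inv t @` finsupp a `|` finsupp b)%fset =>
     (a (t i) * b i)%g].

Lemma finseq_twist_mulE a t b i :
  finseq_twist_mul a t b i = (a (t i) * b i)%g.
Proof.
rewrite fsfunE; case: ifPn => //; rewrite in_fsetU negb_or => /andP[ai bi].
rewrite [b i]fsfun_dflt// mulg1 fsfun_dflt//; apply: contra ai => ati.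
by apply/imfsetP; exists (t i) => //=; rewrite (finpermK t).
Qed.

(** i |-> (a_(t^-1 i))^-1, the sequence t a^-1 t^-1 *)
Definition finseq_twist_inv a t : finseq G :=
  [fsfun i in (t @` finsupp a)%fset => (a (t^-1%g i))^-1%g].

Lemma finseq_twist_invE a t i :
  finseq_twist_inv a t i = ((a (t^-1%g i))^-1)%g.
Proof.
rewrite fsfunE; case: ifPn => // ai.
rewrite fsfun_dflt ?invg1//; apply: contra ai => ati.
by apply/imfsetP; exists (t^-1%g i) => //=; rewrite finpermKV.
Qed.

Definition wreath_mul g h : wreath G :=
  ((g.1 * h.1)%g, finseq_twist_mul g.2 h.1 h.2).
Definition wreath1 : wreath G := (1%g, finseq1).
Definition wreath_inv g : wreath G :=
  ((g.1^-1)%g, finseq_twist_inv g.2 g.1).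

Lemma wreath_mulA : associative wreath_mul.
Proof.
move=> [s a] [t b] [u c]; rewrite /wreath_mul/=; congr pair; first exact: mulgA.
by apply/fsfunP => i; rewrite !finseq_twist_mulE finpermM mulgA.
Qed.

Lemma wreath_mul1 : left_id wreath1 wreath_mul.
Proof.
move=> [s a]; rewrite /wreath_mul/=; congr pair; first exact: mul1g.
by apply/fsfunP => i; rewrite finseq_twist_mulE finseq1E mul1g.
Qed.

Lemma wreath_mulr1 : right_id wreath1 wreath_mul.
Proof.
move=> [s a]; rewrite /wreath_mul/=; congr pair; first exact: mulg1.
by apply/fsfunP => i; rewrite finseq_twist_mulE finseq1E finperm1E mulg1.
Qed.

Lemma wreath_mulV : left_inverse wreath1 wreath_inv wreath_mul.
Proof.
move=> [s a]; rewrite /wreath_mul/=; congr pair; first exact: mulVg.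
apply/fsfunP => i.
by rewrite finseq_twist_mulE finseq_twist_invE finpermK mulVg finseq1E.
Qed.

Lemma wreath_mulrV : right_inverse wreath1 wreath_inv wreath_mul.
Proof.
move=> [s a]; rewrite /wreath_mul/=; congr pair; first exact: mulgV.
apply/fsfunP => i.
by rewrite finseq_twist_mulE finseq_twist_invE mulgV finseq1E.
Qed.

HB.instance Definition _ := isGroup.Build (wreath G)
  wreath_mulA wreath_mul1 wreath_mulr1 wreath_mulV wreath_mulrV.

Definition wperm s : wreath G := (s, finseq1).
Definition wseq a : wreath G := (1%g, a).

Lemma wreathE s a : ((s, a) : wreath G) = (wperm s * wseq a)%g.
Proof.
congr pair; first by rewrite mulg1.
by apply/fsfunP => i; rewrite finseq_twist_mulE finseq1E mul1g.
Qed.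

Lemma wpermM s t : wperm (s * t)%g = (wperm s * wperm t)%g.
Proof.
by congr pair; apply/fsfunP => i; rewrite finseq_twist_mulE !finseq1E mulg1.
Qed.

Lemma wseqM a b i : ((wseq a * wseq b)%g).2 i = (a i * b i)%g.
Proof. by rewrite finseq_twist_mulE finperm1E. Qed.

Lemma wreath_conj s a :
  exists2 b : finseq G, (wperm s * wseq a * (wperm s)^-1)%g = wseq b
                      & forall i, b i = a (s^-1%g i).
Proof.
exists (wperm s * wseq a * (wperm s)^-1)%g.2.
  apply: injective_projections => //.
  by rewrite -[LHS]/(s * 1 * s^-1)%g mulg1 mulgV.
move=> i; rewrite finseq_twist_mulE finseq_twist_mulE finseq_twist_invE !finseq1E.
by rewrite invg1 mulg1 mul1g.
Qed.

Definition wsupp g : set nat := [set i | g.1 i <> i \/ g.2 i <> 1%g].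

(** The orbit of i under the cyclic group generated by s. *)
Definition porbit_of s (i : nat) : set nat :=
  [set j | exists n, j = (s ^+ n)%g i \/ i = (s ^+ n)%g j].

Definition porbits_of s : set (set nat) := range (porbit_of s).

Definition restr_fun s (p : set nat) : {fsfun nat -> nat} :=
  [fsfun i in finsupp s => if i \in p then s i else i].

(** The permutation equal to s on p and to the identity off p; the default
    value 1 is irrelevant when p is an orbit of s, see [finperm_restrE]. *)
Definition finperm_restr s (p : set nat) : finperm := insubd finperm1 (restr_fun s p).

Lemma restr_funE s p i : restr_fun s p i = if i \in p then s i else i.
Proof.
by rewrite fsfunE; case: finsuppP => // _; rewrite if_same.
Qed.

Lemma porbit_of_stable s i j : porbit_of s i (s j) <-> porbit_of s i j.
Proof.
split=> -[n [jE|iE]].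
- case: n jE => [|n] jE.
    by exists 1%N; right; rewrite expg1 jE expg0 finperm1E.
  exists n; left; apply: (bij_inj (finperm_bij s)).
  by rewrite jE expgS finpermM.
- by exists n.+1; right; rewrite expgSr finpermM.
- by exists n.+1; left; rewrite expgS finpermM jE.
- case: n iE => [|n] iE.
    by exists 1%N; left; rewrite expg1 iE expg0 finperm1E.
  by exists n; right; rewrite iE expgSr finpermM.
Qed.

Lemma finperm_restrE s p i : porbits_of s p ->
  finperm_restr s p i = if i \in p then s i else i.
Proof.
move=> [k _ pE]; have sp j : (s j \in p) = (j \in p).
  by apply/idP/idP; rewrite !inE -pE => /porbit_of_stable.
rewrite -restr_funE /finperm_restr /insubd; case: insubP => [u _ <-//|].
case/negP; apply/asboolP.
have s'p j : (s^-1%g j \in p) = (j \in p) by rewrite -(sp (s^-1%g j)) finpermKV.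
exists (fun j => if j \in p then s^-1%g j else j) => j; rewrite restr_funE.
  by case: (boolP (j \in p)) => jp; rewrite ?sp ?jp ?finpermK// (negPf jp).
by case: (boolP (j \in p)) => jp; rewrite ?s'p ?jp ?finpermKV// (negPf jp).
Qed.

Definition finseq_restr a (p : set nat) : finseq G :=
  [fsfun i in finsupp a => if i \in p then a i else 1%g].

Lemma finseq_restrE a p i :
  finseq_restr a p i = if i \in p then a i else 1%g.
Proof.
by rewrite fsfunE; case: finsuppP => // _; rewrite if_same.
Qed.

Definition gcycle g (p : set nat) : wreath G :=
  (wperm (finperm_restr g.1 p) * wseq (finseq_restr g.2 p))%g.

End WreathGroup.

HB.instance Definition _ (G : topologicalGroupType) :=
  Topological.copy (wreath G) (finperm * finseq G)%type.

Section States.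
Variable R : realType.

Definition positive_definite (G : groupType) (phi : G -> R[i]) :=
  forall n (g : 'I_n -> G) (c : 'I_n -> R[i]),
    0 <= \sum_i \sum_j c i * (c j)^* * phi ((g j)^-1 * g i)%g.

Definition state (G : topologicalGroupType) (phi : wreath G -> R[i]^o) :=
  [/\ continuous phi, positive_definite phi & phi 1%g = 1].

Definition Sinf_central (G : groupType) (phi : wreath G -> R[i]) :=
  forall g s, phi (g * wperm G s)%g = phi (wperm G s * g)%g.

End States.

Section Representations.
Variable R : realType.
Local Notation C := R[i].

(** The inner product is linear in the first argument. *)
Record hilbertType := Hilbert {
  hilbert_sort :> completeNormedModType C ;
  inner : {dot hilbert_sort for Num.conj} ;
  innerxx : forall x : hilbert_sort, inner x x = `|x| ^+ 2
}.

Section VonNeumann.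
Variable H : hilbertType.

Definition bounded_operators : set (H -> H) :=
  [set T | linear T /\ continuous T].

Definition commutant (S : set (H -> H)) : set (H -> H) :=
  [set T | bounded_operators T /\ forall A, S A -> T \o A = A \o T].

(** The von Neumann algebra generated by a self-adjoint set of operators. *)
Definition vN_generated (S : set (H -> H)) := commutant (commutant S).

Definition scalar_operators : set (H -> H) :=
  [set T | exists c : C, T = fun x => c *: x].

Definition is_factor (M : set (H -> H)) :=
  M `&` commutant M = scalar_operators.

Variable G : groupType.

Definition unitary_rep (rho : G -> H -> H) :=
  [/\ forall g, linear (rho g),
      forall g x y, inner H (rho g x) (rho g y) = inner H x y,
      rho 1%g = id &
      forall g h, rho (g * h)%g = rho g \o rho h].

Definition orbit_span (rho : G -> H -> H) (xi : H) : set H :=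
  [set x | exists n (c : 'I_n -> C) (g : 'I_n -> G),
     x = \sum_i c i *: rho (g i) xi].

Definition cyclic_vector (rho : G -> H -> H) (xi : H) :=
  closure (orbit_span rho xi) = setT.

Definition GNS_triple (phi : G -> C) (rho : G -> H -> H) (xi : H) :=
  [/\ unitary_rep rho, cyclic_vector rho xi &
      forall g, phi g = inner H (rho g xi) xi].

End VonNeumann.

(** The triples (H, rho, xi) associated with a state exist and are all
    unitarily equivalent (and rho is then strongly continuous), so that the
    choice of one of them is immaterial. *)
Definition indecomposable (G : groupType) (phi : G -> C) :=
  exists (H : hilbertType) (rho : G -> H -> H) (xi : H),
    GNS_triple phi rho xi /\ is_factor (vN_generated (range rho)).

End Representations.

(* Main.v *)
Require Import Defs.
From HB Require Import structures.
From mathcomp Require Import all_boot all_order all_algebra.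
From mathcomp Require Import sesquilinear finmap.
From mathcomp Require Import all_classical all_reals all_analysis.
From mathcomp.real_closed Require Import complex.
From mathcomp Require Import ring zify.
Import Order.TTheory GRing.Theory Num.Theory.
Import numFieldNormedType.Exports.
Local Open Scope classical_set_scope.
Local Open Scope ring_scope.

Set Implicit Arguments.
Unset Strict Implicit.
Unset Printing Implicit Defensive.

(** Write [rho] for the GNS representation of [phi] and [xi] for its cyclic
    vector, so that the inner product of [rho g xi] and [rho h xi] is
    [phi (h^-1 g)].

    A factor gives multiplicativity ([indecomposable_multiplicative]). Let [g']
    be given, and move its support by permutations to pairwise disjoint blocks,
    which gives copies g'_0, g'_1, ... of [g']. As [phi] is central, the vectors
    [rho g'_n x], for [x] in the span of the orbit of [xi], have eventually
    constant mutual inner products. Hence their means over disjoint windows form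
    a Cauchy sequence ([window_mean_cauchy]), and the means of the operators
    [rho g'_n] converge strongly to an operator. This limit belongs to the von
    Neumann algebra of [rho] by construction, and to its commutant because a
    given element commutes with almost all copies. So it is a scalar, which has
    to be [phi g'], and [phi (g g') = phi (g g'_n)] for almost all n yields
    [phi g * phi g'] in the limit.

    Multiplicativity gives a factor ([multiplicative_factor]). Centrality makes
    right translations by permutations unitary; they commute with [rho], so an
    operator [T] of the center commutes with them and with [rho]. Consequently
    [T xi] is fixed by the unitaries that send [rho x xi] to
    [rho (s x s^-1) xi] for a permutation s. When s moves supports away from
    themselves, multiplicativity turns the matrix coefficient of this unitary
    at a vector y of the span into the squared modulus of the inner product of
    y and [xi]; approximating [T xi] by such y shows that [T xi] is a multiple
    of [xi] ([fixed_vector_line]), and [T] is a scalar by cyclicity.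

    The GNS space is the reproducing kernel Hilbert space of the kernel
    [phi (y^-1 x)], made of functions on the group: completeness is checked
    pointwise, and a bijection of the group that preserves the kernel acts by
    composition, for left and for right translations alike.

    The product formula is a combinatorial matter
    ([multiplicative_iff_cycle_prod]): the product over the cycles is itself
    multiplicative for disjoint supports ([cycle_prodM]), and every element is
    the product of one of its nontrivial cycles and an element of smaller,
    disjoint support ([gcycle_split]). *)

(** * Complex numbers *)

(** The discriminant argument behind every Cauchy-Schwarz inequality below,
    isolated from the form: it is applied both to the semi-definite form of a
    kernel and to the inner product of a Hilbert space. *)
Lemma disc_bound (C : numClosedFieldType) (a b z : C) : 0 <= a -> 0 <= b ->
  (forall l : C, 0 <= a + l^* * z + l * z^* + `|l| ^+ 2 * b) ->
  `|z| ^+ 2 <= a * b.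
Proof.
move=> a0 b0 H; have [b_eq0|bN0] := eqVneq b 0.
  have [->|zN0] := eqVneq z 0; first by rewrite normr0 expr0n/= mulr_ge0.
  have z20 : 0 < `|z| ^+ 2 by rewrite exprn_gt0 // normr_gt0.
  (* For b = 0 the expression is affine in l; this t makes it equal to
     - (a + 2), which is negative. *)
  pose t := (a + 1) / `|z| ^+ 2.
  have t_real : t^* = t.
    by rewrite geC0_conj // divr_ge0 ?exprn_ge0 // addr_ge0.
  have /= := H (- (t * z)); rewrite b_eq0 mulr0 addr0 rmorphN rmorphM /= t_real.
  have -> : a + - (t * z^*) * z + - (t * z) * z^* = a - (t * `|z| ^+ 2) * 2.
    by rewrite normCK; ring.
  rewrite /t divfK ?gt_eqF //.
  have -> : a - (a + 1) * 2 = - (a + 2) by ring.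
  rewrite oppr_ge0 => h; exfalso; move: h; apply/negP.
  by rewrite lt_geF // ltr_wpDl.
have b_gt0 : 0 < b by rewrite lt_def bN0.
have b_real : (b^-1)^* = b^-1 by rewrite geC0_conj // invr_ge0.
have := H (- (z / b)); rewrite rmorphN rmorphM /= b_real normrN normrM normfV exprMn.
rewrite (ger0_norm b0).
have -> : a + - (z^* / b) * z + - (z / b) * z^* + `|z| ^+ 2 * b^-1 ^+ 2 * b
   = a - `|z| ^+ 2 / b.
  by rewrite normCK; field.
by rewrite subr_ge0 ler_pdivrMr.
Qed.

Section ComplexComplete.
Variable R : realType.
Local Notation C := R[i].
Implicit Types z : C.

Lemma Re_lipschitz z1 z2 (e : R) : `|z1 - z2| < e%:C%C -> `|complex.Re z1 - complex.Re z2| < e.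
Proof.
move=> h; rewrite -ltcR; apply: le_lt_trans h.
have := normc_ge_Re (z1 - z2); suff -> : complex.Re (z1 - z2) = complex.Re z1 - complex.Re z2 by [].
by case: z1; case: z2.
Qed.

Lemma Im_lipschitz z1 z2 (e : R) : `|z1 - z2| < e%:C%C -> `|complex.Im z1 - complex.Im z2| < e.
Proof.
move=> h; rewrite -ltcR; apply: le_lt_trans h.
rewrite normc_def lecR -sqrtr_sqr ler_wsqrtr //.
by case: z1; case: z2 => a b c d /=; rewrite lerDr sqr_ge0.
Qed.

(** Real and imaginary parts are contractions, so they carry a Cauchy filter
    to Cauchy filters of the complete field [R]. *)
Lemma complex_cauchy_cvg (F : set_system C^o) :
  ProperFilter F -> cauchy F -> cvg F.
Proof.
move=> FF /cauchyP Fc.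
have H (p : C^o -> R) : (forall z1 z2 (e : R), `|z1 - z2| < e%:C%C -> `|p z1 - p z2| < e) ->
   exists l : R, p @ F --> l.
  move=> pl; suff /cvg_ex[l ?] : cvg (p @ F) by exists l.
  apply: cauchy_cvg; apply/cauchyP => e e0.
  have [|z Fz] := Fc (e%:C%C); first by rewrite ltcR.
  exists (p z); move: Fz; apply: (@filterS _ F) => w; rewrite /= -!ball_normE; exact: pl.
have [a ha] := H _ Re_lipschitz; have [b hb] := H _ Im_lipschitz.
apply/cvg_ex; exists ((a +i* b)%C : C^o); apply/cvgrPdist_lt => e e0.
have eE : e = (complex.Re e)%:C%C by rewrite RRe_real // gtr0_real.
move: e0; rewrite eE ltcR => e0.
have e20 : 0 < complex.Re e / 2 by rewrite divr_gt0.
near=> z.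
have ha' : `|a - complex.Re z| < complex.Re e / 2.
  by near: z; move/cvgrPdist_lt: ha; apply.
have hb' : `|b - complex.Im z| < complex.Re e / 2.
  by near: z; move/cvgrPdist_lt: hb; apply.
have -> : (a +i* b)%C - z = (a - complex.Re z)%:C%C + 'i%C * (b - complex.Im z)%:C%C.
  by case: (z) => x y; apply/eqP; rewrite eq_complex /=; apply/andP; split; apply/eqP; ring.
have -> : (complex.Re e)%:C%C = (complex.Re e / 2)%:C%C + (complex.Re e / 2)%:C%C.
  by rewrite -rmorphD -splitr.
rewrite (le_lt_trans (ler_normD _ _)) //.
rewrite ltrD //; first by rewrite normc_def /= expr0n addr0 sqrtr_sqr ltcR.
rewrite normrM !normc_def /= !expr0n expr1n add0r addr0 sqrtr1 sqrtr_sqr.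
by rewrite mul1r ltcR.
Unshelve. all: by end_near. Qed.

End ComplexComplete.

(** * Positive definite kernels *)

(** The convention is that [K x y] is the inner product of the vectors of [x]
    and [y], linear in the first argument. *)
Record pdkernel (R : realType) (X : Type) := PdKernel {
  pdkernel_fun :> X -> X -> R[i] ;
  pdkernel_ge0 : forall c : seq (R[i] * X),
    0 <= \sum_(j <- c) j.1^* * \sum_(i <- c) i.1 * pdkernel_fun i.2 j.2
}.

Section Kernel.
Variables (R : realType) (X : Type) (K : pdkernel R X).
Local Notation C := R[i].
Implicit Types (c d e : seq (C * X)) (f g : X -> C).

(** A sequence [c] of pairs (coefficient, point) stands for a formal linear
    combination. [comb c] is the corresponding combination of the kernel
    functions [K x], and [pairing f c] is the value that the inner product of
    [f] with [comb c] must have for the reproducing property to hold. *)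
Definition comb d : X -> C := fun y => \sum_(i <- d) i.1 * K i.2 y.

Definition pairing f c : C := \sum_(j <- c) j.1^* * f j.2.

Definition combZ (a : C) d := [seq (a * i.1, i.2) | i <- d].

Lemma comb_cat d e : comb (d ++ e) = comb d + comb e.
Proof. by apply/funext => y; rewrite /comb big_cat. Qed.

Lemma comb_scale a d : comb (combZ a d) = a *: comb d.
Proof.
apply/funext => y; rewrite -[RHS]/(a * comb d y) /comb big_map mulr_sumr.
by apply: eq_bigr => i _; rewrite mulrA.
Qed.

Lemma pairingD f g c : pairing (f + g) c = pairing f c + pairing g c.
Proof.
by rewrite /pairing -big_split; apply: eq_bigr => i _; rewrite /= mulrDr.
Qed.

Lemma pairingZ a f c : pairing (a *: f) c = a * pairing f c.
Proof.
by rewrite /pairing mulr_sumr; apply: eq_bigr => i _; rewrite /= mulrCA.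
Qed.

Lemma pairingN f c : pairing (- f) c = - pairing f c.
Proof. by rewrite -scaleN1r pairingZ mulN1r. Qed.

Lemma pairing_cat f c d : pairing f (c ++ d) = pairing f c + pairing f d.
Proof. by rewrite /pairing big_cat. Qed.

Lemma pairing_scale f a c : pairing f (combZ a c) = a^* * pairing f c.
Proof.
rewrite /pairing big_map mulr_sumr; apply: eq_bigr => i _.
by rewrite /= rmorphM mulrA.
Qed.

Lemma pairing1 f x : pairing f [:: (1, x)] = f x.
Proof. by rewrite /pairing big_seq1 /= conjC1 mul1r. Qed.

(** The squared norm of [comb c]; in general only a semi-norm on formal
    combinations. *)
Definition combN2 c : C := pairing (comb c) c.

Lemma combN2_ge0 c : 0 <= combN2 c. Proof. exact: pdkernel_ge0. Qed.

(** Positivity on a two-point combination with coefficients 1 and a says that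
    [a^* K x y + a K y x] is real; the cases a = 1 and a = 'i give the
    symmetry. *)
Lemma pdkernel_herm x y : K y x = (K x y)^*.
Proof.
have H a : a^* * K x y + a * K y x \is Num.real.
  have := ger0_real (combN2_ge0 ([:: (1, x)] ++ combZ a [:: (1, y)])).
  rewrite /combN2 comb_cat comb_scale pairing_cat pairing_scale !pairing1.
  rewrite /= /comb !fctE !big_seq1 /GRing.scale /= !mul1r.
  have -> : K x x + a * K y x + a^* * (K x y + a * K y y) =
     (a^* * K x y + a * K y x) + (K x x + a * a^* * K y y) by ring.
  have Kxx z : K z z \is Num.real.
    have := ger0_real (combN2_ge0 [:: (1, z)]).
    by rewrite /combN2 pairing1 /comb big_seq1 /= mul1r.
  by rewrite rpredDr // rpredD // rpredM // -normCK rpredX // normr_real.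
have /CrealP := H 1; rewrite conjC1 !mul1r rmorphD => h1.
have /CrealP := H 'i; rewrite rmorphD !rmorphM /= conjCi !rmorphN /= conjCi.
rewrite opprK => hi.
have {hi} : (K x y)^* - (K y x)^* = - K x y + K y x.
  by apply: (mulfI (neq0Ci C)); rewrite mulrBr -mulNr hi; ring.
move=> h2; apply: (@mulfI _ 2); first by rewrite pnatr_eq0.
transitivity ((K x y + K y x) + (- K x y + K y x)); first by ring.
by rewrite -h2 -h1; ring.
Qed.

Lemma pairing_comb_conj c d : pairing (comb c) d = (pairing (comb d) c)^*.
Proof.
rewrite /pairing /comb rmorph_sum /=.
under eq_bigr do rewrite mulr_sumr.
rewrite exchange_big; apply: eq_bigr => i _ /=.
rewrite rmorphM /= conjCK rmorph_sum mulr_sumr; apply: eq_bigr => j _.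
by rewrite rmorphM /= -pdkernel_herm mulrCA.
Qed.

Lemma combN2_addZ c d a : combN2 (c ++ combZ a d) =
  combN2 c + a^* * pairing (comb c) d + a * (pairing (comb c) d)^* +
  `|a| ^+ 2 * combN2 d.
Proof.
rewrite -pairing_comb_conj /combN2 comb_cat comb_scale pairing_cat.
by rewrite pairing_scale !pairingD !pairingZ normCK; ring.
Qed.

Lemma pairing_comb_le c d :
  `|pairing (comb d) c| <= sqrtC (combN2 d) * sqrtC (combN2 c).
Proof.
rewrite -sqrtCM ?nnegrE ?combN2_ge0 // -[leLHS]sqrCK //.
rewrite ler_sqrtC ?nnegrE ?mulr_ge0 ?combN2_ge0 ?exprn_ge0 //.
apply: disc_bound; try exact: combN2_ge0.
by move=> l; rewrite -combN2_addZ combN2_ge0.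
Qed.

Definition pairing_bound f (M : C) :=
  forall c, `|pairing f c| <= M * sqrtC (combN2 c).

Lemma pairing_bound_le f M N : M <= N -> pairing_bound f M -> pairing_bound f N.
Proof.
move=> MN fM c; apply: le_trans (fM c) _.
by rewrite ler_wpM2r // sqrtC_ge0 combN2_ge0.
Qed.

Lemma pairing_boundD f g M N : pairing_bound f M -> pairing_bound g N ->
  pairing_bound (f + g) (M + N).
Proof.
move=> fM gN c; rewrite pairingD mulrDl (le_trans (ler_normD _ _)) //.
exact: lerD.
Qed.

Lemma pairing_boundZ a f M : pairing_bound f M ->
  pairing_bound (a *: f) (`|a| * M).
Proof. by move=> fM c; rewrite pairingZ normrM -mulrA ler_wpM2l. Qed.

Lemma pairing_bound_comb d : pairing_bound (comb d) (sqrtC (combN2 d)).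
Proof. by move=> c; exact: pairing_comb_le. Qed.

(** Elements of the completion are realized as functions: those whose pairing
    is, in operator norm, a limit of pairings with combinations. This makes
    limits computable pointwise. *)
Definition approximable f :=
  forall e : C, 0 < e -> exists d, pairing_bound (f - comb d) e.

Lemma approximable_comb d : approximable (comb d).
Proof.
move=> e e0; exists d => c; rewrite subrr.
have -> : pairing 0 c = 0 by rewrite /pairing big1 // => i _; exact: mulr0.
by rewrite normr0 mulr_ge0 ?(ltW e0) ?sqrtC_ge0 ?combN2_ge0.
Qed.

Definition approximable_pred : {pred (X -> C)} := fun f => `[< approximable f >].

Lemma approximable_submod : GRing.submod_closed approximable_pred.
Proof.
split.
  have <- : comb [::] = 0 by apply/funext => y; rewrite /comb big_nil.
  exact/asboolP/approximable_comb.
move=> a f g /asboolP fa /asboolP ga; apply/asboolP => e e0.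
have e1 : 0 < e / 2 / (`|a| + 1).
  by rewrite !divr_gt0 // ltr_wpDl.
have e2 : 0 < e / 2 by rewrite divr_gt0.
have [d fd] := fa _ e1; have [d' gd] := ga _ e2.
exists (combZ a d ++ d'); rewrite comb_cat comb_scale.
have -> : a *: f + g - (a *: comb d + comb d') =
    a *: (f - comb d) + (g - comb d').
  by rewrite scalerBr opprD addrACA.
rewrite [e in pairing_bound _ e]splitr.
apply: pairing_boundD gd; apply: pairing_bound_le (pairing_boundZ a fd).
rewrite mulrCA -[leRHS]mulr1; apply: ler_wpM2l; first exact: ltW.
by rewrite ler_pdivrMr ?mul1r ?lerDl // ltr_wpDl.
Qed.

HB.instance Definition _ :=
  GRing.isSubmodClosed.Build C (X -> C) approximable_pred approximable_submod.

Lemma approximable_bounded f : approximable f ->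
  exists2 M : R, 0 <= M & pairing_bound f (M%:C)%C.
Proof.
move=> /(_ 1 ltr01)[d fd]; have := pairing_boundD fd (pairing_bound_comb d).
rewrite subrK; set M := 1 + _ => fM.
have M0 : 0 <= M by rewrite addr_ge0 ?sqrtC_ge0 ?combN2_ge0.
have ME : M = (complex.Re M)%:C%C by rewrite RRe_real // ger0_real.
exists (complex.Re M); last by rewrite -ME.
by rewrite -lecR -ME.
Qed.

(** The operator norm of [pairing f], as the least bound: the infimum is
    attained, see [pairing_bound_norm]. *)
Definition rkhs_norm f : C :=
  (inf [set M : R | 0 <= M /\ pairing_bound f (M%:C)%C])%:C%C.

Lemma rkhs_norm_ge0 f : 0 <= rkhs_norm f.
Proof.
rewrite /rkhs_norm lecR; set B := [set M | _].
have [->|/set0P ne] := eqVneq B set0.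
  by rewrite inf0.
by apply: lb_le_inf => // M [].
Qed.

Lemma rkhs_norm_le f (M : C) : 0 <= M -> pairing_bound f M -> rkhs_norm f <= M.
Proof.
move=> M0 fM; have ME : M = (complex.Re M)%:C%C by rewrite RRe_real // ger0_real.
rewrite /rkhs_norm ME lecR; apply: ge_inf; first by exists 0 => N [].
by split; rewrite -?ME // -lecR -ME.
Qed.

Lemma pairing_bound_norm f : approximable f -> pairing_bound f (rkhs_norm f).
Proof.
move=> /approximable_bounded[N N0 fN] c; set q := sqrtC _.
have q0 : 0 <= q by rewrite sqrtC_ge0 combN2_ge0.
have qE : q = (complex.Re q)%:C%C by rewrite RRe_real // ger0_real.
rewrite normc_def qE /rkhs_norm -rmorphM lecR.
have [q_eq0|q_neq0] := eqVneq (complex.Re q) 0.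
  by have := fN c; rewrite -/q normc_def qE -rmorphM lecR q_eq0 !mulr0.
have qr0 : 0 < complex.Re q by rewrite lt_def q_neq0 -lecR -qE.
rewrite -ler_pdivrMr //; apply: lb_le_inf; first by exists N.
move=> M [M0 /(_ c)]; rewrite -/q normc_def qE -rmorphM lecR.
by rewrite ler_pdivrMr.
Qed.

(** Point evaluations are bounded, hence convergence in norm implies pointwise
    convergence. *)
Lemma eval_le f x : approximable f ->
  `|f x| <= rkhs_norm f * sqrtC (combN2 [:: (1, x)]).
Proof. by move=> /pairing_bound_norm/(_ [:: (1, x)]); rewrite pairing1. Qed.

Lemma rkhs_normD f g : approximable f -> approximable g ->
  rkhs_norm (f + g) <= rkhs_norm f + rkhs_norm g.
Proof.
move=> /pairing_bound_norm fa /pairing_bound_norm ga.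
by apply: rkhs_norm_le; [rewrite addr_ge0 ?rkhs_norm_ge0|exact: pairing_boundD].
Qed.

Lemma rkhs_normZ a f : approximable f ->
  rkhs_norm (a *: f) = `|a| * rkhs_norm f.
Proof.
move=> fa; have le b g : approximable g -> rkhs_norm (b *: g) <= `|b| * rkhs_norm g.
  move=> /pairing_bound_norm ga; apply: rkhs_norm_le; last exact: pairing_boundZ.
  by rewrite mulr_ge0 ?rkhs_norm_ge0.
apply/eqP; rewrite eq_le le //=; have [->|aN0] := eqVneq a 0.
  by rewrite normr0 mul0r rkhs_norm_ge0.
have afa : approximable (a *: f).
  suff : a *: f \in approximable_pred by move=> /asboolP.
  by apply: rpredZ; exact/asboolP.
have := le a^-1 _ afa; rewrite scalerA mulVf // scale1r normfV.
by rewrite mulrC ler_pdivlMr ?normr_gt0 // mulrC.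
Qed.

Lemma rkhs_norm_eq0 f : approximable f -> rkhs_norm f = 0 -> f = 0.
Proof.
move=> fa f0; apply/funext => x; apply/eqP.
by rewrite -normr_le0 (le_trans (eval_le _ fa)) // f0 mul0r.
Qed.

(** Cauchy-Schwarz gives one inequality; pairing [comb d] with [d] itself gives
    the other one. *)
Lemma rkhs_norm_comb d : rkhs_norm (comb d) = sqrtC (combN2 d).
Proof.
apply/eqP; rewrite eq_le rkhs_norm_le ?sqrtC_ge0 ?combN2_ge0 //=; last exact: pairing_bound_comb.
have [->|qN0] := eqVneq (sqrtC (combN2 d)) 0; first exact: rkhs_norm_ge0.
have q0 : 0 < sqrtC (combN2 d) by rewrite lt_def qN0 sqrtC_ge0 combN2_ge0.
have := pairing_bound_norm (approximable_comb d) d.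
by rewrite -/(combN2 d) ger0_norm ?combN2_ge0 // -{1}[combN2 d]sqrtCK expr2 ler_pM2r.
Qed.

End Kernel.

Record rkhs (R : realType) (X : Type) (K : pdkernel R X) := Rkhs {
  rkhs_fun :> X -> R[i] ;
  _ : rkhs_fun \in approximable_pred K
}.

HB.instance Definition _ R X (K : pdkernel R X) := [isSub for @rkhs_fun R X K].
HB.instance Definition _ R X (K : pdkernel R X) := [Choice of rkhs K by <:].
HB.instance Definition _ R X (K : pdkernel R X) :=
  [SubChoice_isSubLmodule of rkhs K by <:].

(** * The space of approximable functions is complete *)

Section RKHS.
Variables (R : realType) (X : Type) (K : pdkernel R X).
Local Notation C := R[i].
Local Notation H := (rkhs K).
Implicit Types (f g h : H) (c d : seq (C * X)).

Lemma rkhsP f : approximable K f. Proof. by case: f => f /= /asboolP. Qed.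

Lemma rkhs_ler_normD f g :
  rkhs_norm K (f + g) <= rkhs_norm K f + rkhs_norm K g.
Proof. by apply: rkhs_normD; exact: rkhsP. Qed.

Lemma rkhs_normrZ a f : rkhs_norm K (a *: f) = `|a| * rkhs_norm K f.
Proof. by apply: rkhs_normZ; exact: rkhsP. Qed.

Lemma rkhs_normr0_eq0 f : rkhs_norm K f = 0 -> f = 0.
Proof. by move=> f0; apply/val_inj/(rkhs_norm_eq0 (rkhsP f) f0). Qed.

HB.instance Definition _ := Lmodule_isNormed.Build C H
  rkhs_ler_normD rkhs_normrZ rkhs_normr0_eq0.

Lemma rkhs_normE f : `|f| = rkhs_norm K f. Proof. by []. Qed.

Lemma pairing_le f c : `|pairing f c| <= `|f| * sqrtC (combN2 K c).
Proof. exact/pairing_bound_norm/rkhsP. Qed.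

(** The limit [l] of a Cauchy filter is computed pointwise. Bounds on pairings
    with a fixed combination involve finitely many points only, so they pass to
    [l]; this yields both the convergence in norm and the approximability of
    [l]. *)
Lemma rkhs_complete (F : set_system H) : ProperFilter F -> cauchy F -> cvg F.
Proof.
move=> FF /cauchyP Fc.
have eval_cvg x : cvg ((fun f : H => f x : C^o) @ F).
  apply: complex_cauchy_cvg; apply/cauchyP => e e0.
  pose q := sqrtC (combN2 K [:: (1, x)]) + 1.
  have q0 : 0 < q by rewrite ltr_wpDl // sqrtC_ge0 combN2_ge0.
  have [|f Ff] := Fc (e / q); first by rewrite divr_gt0.
  exists (f x); move: Ff; apply: (@filterS _ F) => g.
  rewrite /= -!ball_normE /= ltr_pdivlMr // => fg; apply: le_lt_trans fg.
  have := pairing_le (f - g) [:: (1, x)]; rewrite pairing1 => /le_trans; apply.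
  by rewrite ler_wpM2l // lerDl.
pose l x : C := lim ((fun f : H => f x : C^o) @ F).
have pair_cvg c : (fun f : H => pairing f c : C^o) @ F --> (pairing l c : C^o).
  elim: c => [|j c IH].
    have -> : (fun f : H => pairing f [::] : C^o) = cst (pairing l [::]).
      by apply/funext => f; rewrite /pairing !big_nil.
    exact: cvg_cst.
  have pcons (f : X -> C) : pairing f (j :: c) = (j.1^* *: (f j.2 : C^o) + pairing f c : C^o).
    by rewrite /pairing big_cons.
  rewrite pcons (_ : (fun f : H => pairing f (j :: c)) =
    (fun f : H => j.1^* *: (f j.2 : C^o) + pairing f c : C^o)); last first.
    by apply/funext => f; rewrite pcons.
  apply: cvgD IH; apply: cvgZl_tmp; exact: eval_cvg.
have near_l e : 0 < e -> \forall f \near F, pairing_bound K (rkhs_fun f - l) e.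
  move=> e0; have [|f Ff] := Fc (e / 2); first by rewrite divr_gt0.
  apply: filterS (Ff) => g; rewrite -ball_normE /= => fg c.
  set q := sqrtC _; have q0 : 0 <= q by rewrite sqrtC_ge0 combN2_ge0.
  apply/ler_addgt0Pr => d d0.
  have [h [hf /= hl]] := filter_ex (filterI Ff (cvgr_dist_lt _ _ (pair_cvg c) _ d0)).
  move: hf; rewrite -ball_normE /= => fh.
  rewrite pairingD pairingN.
  have -> : pairing g c - pairing l c = pairing (g - h) c + (pairing h c - pairing l c).
    by rewrite pairingD pairingN addrA subrK.
  rewrite (le_trans (ler_normD _ _)) // lerD //; last by rewrite distrC ltW.
  rewrite (le_trans (pairing_le _ _)) // ler_wpM2r //.
  rewrite -[g](subrK f) -addrA (le_trans (ler_normD _ _)) // [e]splitr.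
  by rewrite lerD // ltW // distrC.
have lP : l \in approximable_pred K.
  apply/asboolP => e e0.
  have e20 : 0 < e / 2 by rewrite divr_gt0.
  have [f fl] := filter_ex (near_l _ e20).
  have [d fd] := rkhsP f e20; exists d.
  rewrite [e in pairing_bound _ _ e]splitr.
  have -> : l - comb K d = -1 *: (rkhs_fun f - l) + (rkhs_fun f - comb K d).
    by rewrite scaleN1r opprB addrA subrK.
  apply: pairing_boundD fd; have := pairing_boundZ (-1) fl.
  by rewrite normrN1 mul1r.
apply/cvg_ex; exists (Rkhs lP); apply/cvgrPdist_le => e e0.
apply: filterS (near_l e e0) => f fl; rewrite rkhs_normE.
apply: rkhs_norm_le; first exact: ltW.
by have := pairing_boundZ (-1) fl; rewrite normrN1 mul1r scaleN1r opprB.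
Qed.

HB.instance Definition _ := Uniform_isComplete.Build H rkhs_complete.

End RKHS.

(** * Polarization on a dense subset *)

Section Polarization.
Variables (C : numClosedFieldType) (V : normedModType C).
Implicit Types x y z : V.

(** The principle by which identities known for combinations extend to the
    completion. *)
Lemma dense_eq (W : normedModType C) (D : set V) (p q : V -> W) :
  closure D = setT -> continuous p -> continuous q ->
  (forall x, D x -> p x = q x) -> p =1 q.
Proof.
move=> Dd pc qc pq x.
have cl : closed [set x | p x - q x = 0].
  apply: (@closed_comp _ _ (fun x => p x - q x) [set 0]) => [y _|].
    by apply: cvgB; [exact: pc|exact: qc].
  exact: accessible_closed_set1 (hausdorff_accessible (@norm_hausdorff _ _)) _.
suff : closure [set x | p x - q x = 0] x.
  by rewrite -(closure_id _).1 // => /eqP; rewrite subr_eq0 => /eqP.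
by apply: (@closure_subset _ D); [move=> y /pq /= ->; rewrite subrr|rewrite Dd].
Qed.

(** On the completion the inner product is recovered from the norm, which makes
    its continuity immediate; the algebraic identities then only have to be
    checked on a dense subset. *)
Definition polar x y : C := 4^-1 * ((`|x + y| ^+ 2 - `|x - y| ^+ 2) +
  'i * (`|x + 'i *: y| ^+ 2 - `|x - 'i *: y| ^+ 2)).

Lemma polar_self x : polar x x = `|x| ^+ 2.
Proof.
rewrite /polar subrr normr0.
have -> : x + x = 2 *: x by rewrite scaler_nat mulr2n.
have -> : x + 'i *: x = (1 + 'i) *: x by rewrite scalerDl scale1r.
have -> : x - 'i *: x = (1 - 'i) *: x by rewrite scalerBl scale1r.
rewrite !normrZ !exprMn !normCK conjC_nat rmorphB rmorphD /= conjCi conjC1.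
by field.
Qed.

Lemma polar_continuousl y : continuous (polar^~ y).
Proof.
have sq (f : V -> V) : continuous f -> continuous (fun x => `|f x| ^+ 2 : C).
  move=> fc x; apply: cvgM; apply: cvg_norm; exact: fc.
have add z : continuous (fun x : V => x + z).
  by move=> x; apply: cvgD; [exact: cvg_id|exact: cvg_cst].
move=> x; apply: cvgM; first exact: cvg_cst.
apply: cvgD; first by apply: cvgB; apply: (sq (fun x => x + _)); exact: add.
by apply: cvgM; [exact: cvg_cst|apply: cvgB; apply: (sq (fun x => x + _)); exact: add].
Qed.

Lemma polar_continuousr x : continuous (polar x).
Proof.
have sq (f : V -> V) : continuous f -> continuous (fun x => `|f x| ^+ 2 : C).
  move=> fc z; apply: cvgM; apply: cvg_norm; exact: fc.
have add (a : C) : continuous (fun y : V => x + a *: y).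
  move=> y; apply: cvgD; [exact: cvg_cst|apply: cvgZl_tmp; exact: cvg_id].
have addb (a : C) : continuous (fun y : V => x - a *: y).
  rewrite (_ : (fun y => _) = (fun y => x + - a *: y)) //.
  by apply/funext => y; rewrite scaleNr.
have add1 : continuous (fun y : V => x + y).
  by move=> y; apply: cvgD; [exact: cvg_cst|exact: cvg_id].
have addb1 : continuous (fun y : V => x - y).
  by move=> y; apply: cvgB; [exact: cvg_cst|exact: cvg_id].
move=> y; apply: cvgM; first exact: cvg_cst.
apply: cvgD; first by apply: cvgB; [exact: (sq _ add1)|exact: (sq _ addb1)].
by apply: cvgM; [exact: cvg_cst|apply: cvgB; [exact: (sq _ (add _))|exact: (sq _ (addb _))]].
Qed.

Section Dense.
Variable D : set V.
Hypothesis Dd : closure D = setT.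
Hypothesis DlinZ : forall a x y z, D x -> D y -> D z ->
  polar (a *: x + y) z = a * polar x z + polar y z.
Hypothesis Dherm : forall x y, D x -> D y -> polar y x = (polar x y)^*.

Lemma polar_linear a x y z : polar (a *: x + y) z = a * polar x z + polar y z.
Proof.
have affl b w : continuous (fun x : V => b *: x + w).
  move=> v; apply: cvgD; [apply: cvgZl_tmp; exact: cvg_id|exact: cvg_cst].
have affr w : continuous (fun x : V => w + x).
  by move=> v; apply: cvgD; [exact: cvg_cst|exact: cvg_id].
have cl b w t : continuous (fun x : V => polar (b *: x + w) t).
  move=> v; apply: (@continuous_comp _ _ _ (fun x => b *: x + w) (polar^~ t));
    [exact: affl|exact: polar_continuousl].
have cr w t : continuous (fun x : V => polar (w + x) t).
  move=> v; apply: (@continuous_comp _ _ _ (fun x => w + x) (polar^~ t));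
    [exact: affr|exact: polar_continuousl].
have mc b (f : V -> C) c : continuous f -> continuous (fun x => b * f x + c).
  move=> fc v; apply: cvgD; last exact: cvg_cst.
  by apply: cvgM; [exact: cvg_cst|exact: fc].
have ca b (f : V -> C) : continuous f -> continuous (fun x => b + f x).
  by move=> fc v; apply: cvgD; [exact: cvg_cst|exact: fc].
move: x; apply: (@dense_eq C^o D (fun x => polar (a *: x + y) z)
    (fun x => a * polar x z + polar y z)) => [//|||x Dx].
- exact: cl.
- by apply: mc; exact: polar_continuousl.
move: y; apply: (@dense_eq C^o D (fun y => polar (a *: x + y) z)
    (fun y => a * polar x z + polar y z)) => [//|||y Dy].
- exact: cr.
- by apply: ca; exact: polar_continuousl.
move: z; apply: (@dense_eq C^o D (polar (a *: x + y))
    (fun z => a * polar x z + polar y z)) => [//||v|z Dz]; last exact: DlinZ.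
  exact: polar_continuousr.
apply: cvgD; last exact: polar_continuousr.
by apply: cvgM; [exact: cvg_cst|exact: polar_continuousr].
Qed.

Lemma polar_herm x y : polar y x = (polar x y)^*.
Proof.
have conj_cont (f : V -> C) : continuous f -> continuous (fun x => (f x)^*).
  move=> fc v; apply/cvgrPdist_lt => e e0.
  move/cvgrPdist_lt: (fc v) => /(_ _ e0); apply: filterS => w.
  by rewrite -rmorphB norm_conjC.
move: x; apply: (@dense_eq C^o D (polar y) (fun x => (polar x y)^*)) => [//|||x Dx].
- exact: polar_continuousr.
- exact: (conj_cont (polar^~ y) (@polar_continuousl _)).
move: y; apply: (@dense_eq C^o D (polar^~ x) (fun y => (polar x y)^*)) => [//|||y Dy].
- exact: polar_continuousl.
- exact: (conj_cont (polar x) (@polar_continuousr _)).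
exact: Dherm.
Qed.

End Dense.
End Polarization.

(** * The reproducing kernel Hilbert space *)

Section RKHSInner.
Variables (R : realType) (X : Type) (K : pdkernel R X).
Local Notation C := R[i].
Local Notation H := (rkhs K).
Implicit Types (f g h : H) (c d e : seq (C * X)).

Lemma comb_mem d : comb K d \in approximable_pred K.
Proof. by apply/asboolP/approximable_comb. Qed.

Definition rkcomb d : H := Rkhs (comb_mem d).

Lemma rkcomb_cat d e : rkcomb (d ++ e) = rkcomb d + rkcomb e.
Proof. by apply/val_inj; rewrite /= comb_cat. Qed.

Lemma rkcombZ a d : rkcomb (combZ a d) = a *: rkcomb d.
Proof. by apply/val_inj; rewrite /= comb_scale. Qed.

Lemma rkcomb_dense : closure (range rkcomb) = setT.
Proof.
rewrite -subTset => f _ B /nbhs_normP[e /= e0 eB].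
have e20 : 0 < e / 2 by rewrite divr_gt0.
have [d fd] := rkhsP f e20; exists (rkcomb d); split; first by exists d.
apply: eB; rewrite /= rkhs_normE.
apply: le_lt_trans (rkhs_norm_le (ltW e20) fd) _.
by rewrite ltr_pdivrMr // mulr_natr mulr2n ltrDl.
Qed.

Lemma rkcomb_norm2 d : `|rkcomb d| ^+ 2 = combN2 K d.
Proof. by rewrite rkhs_normE rkhs_norm_comb sqrtCK. Qed.

(** On combinations the polarization formula returns the form of the kernel,
    because there the squared norm is that form. *)
Lemma polar_rkcomb d e : polar (rkcomb d) (rkcomb e) = pairing (comb K d) e.
Proof.
rewrite /polar.
have -> : rkcomb d + rkcomb e = rkcomb (d ++ combZ 1 e).
  by rewrite rkcomb_cat rkcombZ scale1r.
have -> : rkcomb d - rkcomb e = rkcomb (d ++ combZ (-1) e).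
  by rewrite rkcomb_cat rkcombZ scaleN1r.
have -> : rkcomb d + 'i *: rkcomb e = rkcomb (d ++ combZ 'i e).
  by rewrite rkcomb_cat rkcombZ.
have -> : rkcomb d - 'i *: rkcomb e = rkcomb (d ++ combZ (- 'i) e).
  by rewrite rkcomb_cat rkcombZ scaleNr.
rewrite !rkcomb_norm2 !combN2_addZ !rmorphN /= !normrN conjC1 conjCi normCi normr1.
set z := pairing _ _; set a := combN2 K d; set b := combN2 K e.
have i2 : 'i * 'i = -1 :> C by rewrite -expr2 sqrCi.
transitivity (4^-1 * (2 * (z + z^*) - ('i * 'i) * (2 * z - 2 * z^*))); first by ring.
by rewrite i2; field.
Qed.

Definition rkhs_inner : H -> H -> C := @polar C H.

Lemma rkhs_inner_linear a x y z :
  rkhs_inner (a *: x + y) z = a * rkhs_inner x z + rkhs_inner y z.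
Proof.
apply: (polar_linear rkcomb_dense) => {}a _ _ _ [c _ <-] [d _ <-] [e _ <-].
by rewrite -rkcombZ -rkcomb_cat !polar_rkcomb comb_cat pairingD comb_scale pairingZ.
Qed.

Lemma rkhs_inner_herm x y : rkhs_inner y x = (rkhs_inner x y)^*.
Proof.
apply: (polar_herm rkcomb_dense) => _ _ [c _ <-] [d _ <-].
by rewrite !polar_rkcomb pairing_comb_conj.
Qed.

Lemma rkhs_inner_bilinear : bilinear_for
  (GRing.Scale.Law.clone _ _ ( *%R ) _) (GRing.Scale.Law.clone _ _ (Num.conj \; *%R) _)
  rkhs_inner.
Proof.
split=> [z|z] a x y /=; first exact: rkhs_inner_linear.
rewrite rkhs_inner_herm rkhs_inner_linear rmorphD rmorphM /=.
by congr (_ * _ + _); exact/esym/rkhs_inner_herm.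
Qed.

HB.instance Definition _ := bilinear_isBilinear.Build C H H C _ _ rkhs_inner
  rkhs_inner_bilinear.

Lemma rkhs_inner_hermitian x y :
  rkhs_inner x y = (-1) ^+ false * (rkhs_inner y x)^*.
Proof. by rewrite expr0 mul1r rkhs_inner_herm. Qed.

HB.instance Definition _ :=
  isHermitianSesquilinear.Build C H false Num.conj rkhs_inner rkhs_inner_hermitian.

Lemma rkhs_innerxx x : rkhs_inner x x = `|x| ^+ 2.
Proof. exact: polar_self. Qed.

Lemma rkhs_inner_gt0 x : x != 0 -> 0 < rkhs_inner x x.
Proof. by move=> x0; rewrite rkhs_innerxx exprn_gt0 // normr_gt0. Qed.

HB.instance Definition _ := isDotProduct.Build C H rkhs_inner rkhs_inner_gt0.

Definition rkhs_hilbert : hilbertType R :=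
  @Hilbert R H rkhs_inner rkhs_innerxx.

Definition rkpoint x : H := rkcomb [:: (1, x)].

Lemma rkcombE d : rkcomb d = \sum_(i <- d) i.1 *: rkpoint i.2.
Proof.
elim: d => [|[a x] d IH].
  by rewrite big_nil; apply/val_inj/funext => y; rewrite /= /comb big_nil.
rewrite big_cons -IH -rkcombZ -rkcomb_cat; congr rkcomb.
by rewrite /= mulr1.
Qed.

Lemma rkpoint_inner x y : rkhs_inner (rkpoint x) (rkpoint y) = K x y.
Proof.
by rewrite /rkhs_inner polar_rkcomb pairing1 /comb big_seq1 mul1r.
Qed.

(** A bijection of the points that preserves the kernel acts by a unitary
    operator. Left translations give the representation, right translations by
    permutations give operators of its commutant. *)
Section Shift.
Variables (s t : X -> X) (ts : cancel t s) (st : cancel s t).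
Hypothesis Ks : forall x y, K (s x) (s y) = K x y.

Let sc (u : X -> X) d := [seq (i.1, u i.2) | i <- d].

Lemma comb_shift d : comb K d \o t = comb K (sc s d).
Proof.
apply/funext => y; rewrite /comb /= big_map; apply: eq_bigr => i _ /=.
by rewrite -[y in RHS]ts Ks.
Qed.

Lemma pairing_shift (f : X -> C) c : pairing (f \o t) c = pairing f (sc t c).
Proof. by rewrite /pairing big_map. Qed.

Lemma combN2_shift c : combN2 K (sc t c) = combN2 K c.
Proof.
rewrite /combN2 -pairing_shift comb_shift /sc -map_comp.
by congr (pairing (comb K _) _); rewrite -[RHS]map_id; apply: eq_map => -[a x] /=; rewrite ts.
Qed.

Lemma pairing_bound_shift (f : X -> C) M :
  pairing_bound K f M -> pairing_bound K (f \o t) M.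
Proof. by move=> fM c; rewrite pairing_shift -combN2_shift. Qed.

Lemma shift_mem f : (rkhs_fun f \o t) \in approximable_pred K.
Proof.
apply/asboolP => e e0; have [d fd] := rkhsP f e0.
exists (sc s d); rewrite -comb_shift.
exact: (pairing_bound_shift fd).
Qed.

Definition rkshift f : H := Rkhs (shift_mem f).

Lemma rkshift_linear : linear rkshift.
Proof. by move=> a f g; apply/val_inj. Qed.

Lemma rkshift_point x : rkshift (rkpoint x) = rkpoint (s x).
Proof. by apply/val_inj; rewrite /= comb_shift. Qed.

Lemma rkshift_norm f : `|rkshift f| = `|f|.
Proof.
rewrite !rkhs_normE; apply/eqP; rewrite eq_le; apply/andP; split.
  apply: rkhs_norm_le (rkhs_norm_ge0 _ _) _.
  exact/pairing_bound_shift/pairing_bound_norm/rkhsP.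
apply: rkhs_norm_le (rkhs_norm_ge0 _ _) _ => c.
have cE : sc t (sc s c) = c.
  by rewrite /sc -map_comp -[RHS]map_id; apply: eq_map => -[a x] /=; rewrite st.
rewrite -{1}cE -pairing_shift -[in combN2 _ c]cE combN2_shift.
exact: pairing_bound_norm (rkhsP (rkshift f)) _.
Qed.

Lemma rkshift_inner f g : rkhs_inner (rkshift f) (rkshift g) = rkhs_inner f g.
Proof.
have E (a : C) : rkshift f + a *: rkshift g = rkshift (f + a *: g).
  by apply/val_inj.
rewrite /rkhs_inner /polar.
have -> : rkshift f + rkshift g = rkshift (f + g) by apply/val_inj.
have -> : rkshift f - rkshift g = rkshift (f - g) by apply/val_inj.
have -> : rkshift f - 'i *: rkshift g = rkshift (f - 'i *: g) by apply/val_inj.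
by rewrite E !rkshift_norm.
Qed.

End Shift.
End RKHSInner.

(** * Supports, conjugation and blocks in the wreath product *)

Section WreathSupport.
Variable G : groupType.
Implicit Types (g h w : wreath G) (s t : finperm) (i : nat).

Lemma wreath1_1 i : (1%g : wreath G).1 i = i. Proof. exact: finperm1E. Qed.

Lemma wreath1_2 i : (1%g : wreath G).2 i = 1%g. Proof. exact: finseq1E. Qed.

Lemma wreathM1 g h i : (g * h)%g.1 i = g.1 (h.1 i).
Proof. exact: finpermM. Qed.

Lemma wreathM2 g h i : (g * h)%g.2 i = (g.2 (h.1 i) * h.2 i)%g.
Proof. exact: finseq_twist_mulE. Qed.

Lemma wreathP g h : g.1 =1 h.1 -> g.2 =1 h.2 -> g = h.
Proof.
case: g h => [s a] [t b] /= st ab; congr pair; first exact: finpermP.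
exact/fsfunP.
Qed.

Lemma wsuppN g i : ~ wsupp g i -> g.1 i = i /\ g.2 i = 1%g.
Proof. by move=> /not_orP[/contrapT ? /contrapT ?]. Qed.

Lemma wsupp_stable g i : wsupp g (g.1 i) <-> wsupp g i.
Proof.
split=> [|gi]; first by apply: contraPP => gi; have [-> _] := wsuppN gi.
have [gii|gii] := pselect (g.1 i = i); first by rewrite gii.
by left=> /(bij_inj (finperm_bij _)).
Qed.

Lemma wsupp1 : wsupp (1%g : wreath G) = set0.
Proof. by apply/seteqP; split=> // i [] /=; rewrite ?wreath1_1 ?wreath1_2. Qed.

Lemma wsupp_eq0 g : wsupp g = set0 -> g = 1%g.
Proof.
move=> g0; have H i : ~ wsupp g i by rewrite g0.
apply: wreathP => i; have [] := wsuppN (H i).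
  by rewrite wreath1_1.
by rewrite wreath1_2.
Qed.

Lemma wsuppM g h i : wsupp (g * h)%g i -> wsupp g i \/ wsupp h i.
Proof.
apply: contraPP => /not_orP[/wsuppN[gi gi2] /wsuppN[hi hi2]].
by move=> []; rewrite ?wreathM1 ?wreathM2 hi ?gi ?gi2 ?hi2 ?mulg1.
Qed.

Lemma wsuppV g i : wsupp g^-1%g i -> wsupp g i.
Proof.
apply: contraPP => /wsuppN[gi gi2] [].
  by apply; rewrite -{1}gi -wreathM1 mulVg wreath1_1.
apply; have : (g^-1 * g)%g.2 i = 1%g by rewrite mulVg wreath1_2.
by rewrite wreathM2 gi gi2 mulg1.
Qed.

Lemma wsupp_bounded g : exists n, forall i, wsupp g i -> (i < n)%N.
Proof.
exists (\max_(i <- (finsupp g.1 `|` finsupp g.2)%fset) i).+1 => i gi.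
rewrite ltnS; apply: (@leq_bigmax_seq _ _ xpredT id) => //.
rewrite in_fsetU; case: gi => /eqP; rewrite -[_ != _]/(_ != _) => gi.
  by rewrite mem_finsupp gi.
by rewrite [in X in _ || X]mem_finsupp gi orbT.
Qed.

Definition wdisjoint g h := forall i, wsupp g i -> ~ wsupp h i.

Lemma wdisjoint_sym g h : wdisjoint g h -> wdisjoint h g.
Proof. by move=> gh i hi /gh. Qed.

Lemma wdisjointM g h w : wdisjoint g w -> wdisjoint h w -> wdisjoint (g * h)%g w.
Proof. by move=> gw hw i /wsuppM[/gw|/hw]. Qed.

Lemma wdisjointV g w : wdisjoint g w -> wdisjoint g^-1%g w.
Proof. by move=> gw i /wsuppV/gw. Qed.

(** A product of elements with disjoint supports acts as one of the factors at
    each place; commutation and the description of orbits follow from this. *)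
Lemma wdisjoint_mulE g h i : wdisjoint g h ->
  (wsupp g i -> (g * h)%g.1 i = g.1 i /\ (g * h)%g.2 i = g.2 i) /\
  (~ wsupp g i -> (g * h)%g.1 i = h.1 i /\ (g * h)%g.2 i = h.2 i).
Proof.
move=> gh; rewrite !wreathM1 !wreathM2; split=> gi.
  by have [-> ->] := wsuppN (gh _ gi); rewrite mulg1.
have [->|] : h.1 i = i \/ wsupp h i by case: (pselect (h.1 i = i)); [left|right; left].
  by have [-> ->] := wsuppN gi; rewrite mul1g.
move=> /wsupp_stable/(wdisjoint_sym gh)/wsuppN[-> ->].
by rewrite mul1g.
Qed.

Lemma wdisjoint_comm g h : wdisjoint g h -> (g * h = h * g)%g.
Proof.
move=> gh; have hg := wdisjoint_sym gh.
apply: wreathP => i; have [gi|gi] := pselect (wsupp g i).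
- have [/(_ gi)[-> _] _] := wdisjoint_mulE i gh.
  by have [_ /(_ (gh _ gi))[-> _]] := wdisjoint_mulE i hg.
- have [_ /(_ gi)[-> _]] := wdisjoint_mulE i gh.
  have [hi|hi] := pselect (wsupp h i).
    by have [/(_ hi)[-> _] _] := wdisjoint_mulE i hg.
  by have [_ /(_ hi)[-> _]] := wdisjoint_mulE i hg; rewrite !(wsuppN _).1.
- have [/(_ gi)[_ ->] _] := wdisjoint_mulE i gh.
  by have [_ /(_ (gh _ gi))[_ ->]] := wdisjoint_mulE i hg.
- have [_ /(_ gi)[_ ->]] := wdisjoint_mulE i gh.
  have [hi|hi] := pselect (wsupp h i).
    by have [/(_ hi)[_ ->] _] := wdisjoint_mulE i hg.
  by have [_ /(_ hi)[_ ->]] := wdisjoint_mulE i hg; rewrite !(wsuppN _).2.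
Qed.

Lemma wsuppM_disjoint g h : wdisjoint g h ->
  wsupp (g * h)%g = wsupp g `|` wsupp h.
Proof.
move=> gh; apply/seteqP; split=> i; first exact: wsuppM.
have [gi|gi] := pselect (wsupp g i).
  have [/(_ gi)[e1 e2] _] := wdisjoint_mulE i gh.
  by move=> _; rewrite /wsupp /= e1 e2; exact: gi.
have [_ /(_ gi)[e1 e2]] := wdisjoint_mulE i gh.
by move=> [//|hi]; rewrite /wsupp /= e1 e2; exact: hi.
Qed.

Definition wconj s g : wreath G := (wperm G s * g * wperm G s^-1)%g.

Lemma wconjM s g h : wconj s (g * h)%g = (wconj s g * wconj s h)%g.
Proof.
rewrite /wconj !mulgA -(mulgA _ (wperm G s^-1)%g (wperm G s)) -wpermM mulVg.
by rewrite mulg1.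
Qed.

Lemma wconj1 s : wconj s 1%g = 1%g.
Proof. by rewrite /wconj mulg1 -wpermM mulgV. Qed.

Lemma wconjV s g : wconj s g^-1%g = (wconj s g)^-1%g.
Proof. by apply/esym/mulg1_eq; rewrite -wconjM mulgV wconj1. Qed.

Lemma wconj_mulVM s g h w :
  wconj s (w * (g^-1 * h))%g = (wconj s w * ((wconj s g)^-1 * wconj s h))%g.
Proof. by rewrite !wconjM wconjV. Qed.

Lemma wconj_comp s t g : wconj s (wconj t g) = wconj (s * t)%g g.
Proof. by rewrite /wconj invgM !wpermM !mulgA. Qed.

Lemma wsupp_conj s g i : wsupp (wconj s g) i -> wsupp g (s^-1%g i).
Proof.
move=> H; have {H} : ~ ((wconj s g).1 i = i /\ (wconj s g).2 i = 1%g).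
  by move=> [h1 h2]; case: H.
apply: contraPP => /wsuppN[g1 g2]; apply; rewrite /wconj !wreathM1 !wreathM2 /=.
by rewrite !finseq1E g1 g2 finpermKV !mul1g.
Qed.

Lemma wsupp_perm s i : wsupp (wperm G s) i <-> s i <> i.
Proof. by split=> [[//|]|]; [rewrite finseq1E|left]. Qed.

Lemma wconj_id s g : (forall i, wsupp g i -> s i = i) -> wconj s g = g.
Proof.
move=> sg; have sd : wdisjoint g (wperm G s) by move=> i /sg si /wsupp_perm.
rewrite /wconj -(wdisjoint_comm sd) -mulgA -wpermM mulgV.
by rewrite [X in (_ * X)%g](_ : _ = 1%g) ?mulg1.
Qed.

(** The conjugate depends only on the values of the permutation on the support,
    which leaves the freedom to choose convenient permutations elsewhere. *)
Lemma wconj_eq s t g : (forall i, wsupp g i -> s i = t i) ->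
  wconj s g = wconj t g.
Proof.
move=> st; have -> : s = (t * (t^-1 * s))%g by rewrite mulgA mulgV mul1g.
rewrite -wconj_comp; congr wconj.
by apply: wconj_id => i /st; rewrite finpermM => ->; rewrite finpermK.
Qed.

End WreathSupport.

Section FinpermInvolution.
Variables (f : nat -> nat) (n : nat).
Hypotheses (fK : involutive f) (fn : forall i, (n <= i)%N -> f i = i).

Let f_fun : {fsfun nat -> nat} := [fsfun i in [fset val j | j : 'I_n]%fset => f i].

Let f_funE i : f_fun i = f i.
Proof.
rewrite fsfunE; case: ifPn => // /imfsetP ni.
have [ni'|/fn->//] := ltnP i n.
by case: ni; exists (Ordinal ni').
Qed.

Lemma finperm_of_involution : exists s : finperm, s =1 f.
Proof.
have fb : `[< bijective f_fun >].
  by apply/asboolP; exists f_fun => i; rewrite !f_funE fK.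
by exists (Finperm fb) => i; exact: f_funE.
Qed.

End FinpermInvolution.

(** Exchanges the m-th and the n-th interval of length [d] by a translation. *)
Definition block_swap (d m n i : nat) : nat :=
  if (i %/ d == m)%N then (n * d + i %% d)%N
  else if (i %/ d == n)%N then (m * d + i %% d)%N else i.

Lemma block_swapK d m n : (0 < d)%N -> involutive (block_swap d m n).
Proof.
move=> d0 i; rewrite /block_swap.
have H k : ((k * d + i %% d) %/ d = k)%N.
  by rewrite divnMDl // divn_small ?addn0 // ltn_mod.
have H2 k : ((k * d + i %% d) %% d = i %% d)%N by rewrite modnMDl modn_mod.
case: (eqVneq (i %/ d)%N m) => [im|im].
  by rewrite H H2 eqxx; case: eqP => [->|_]; rewrite -?im -divn_eq.
case: (eqVneq (i %/ d)%N n) => [iN|iN].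
  by rewrite H H2 eqxx -iN -divn_eq.
by rewrite (negPf im) (negPf iN).
Qed.

Lemma bswap_exists d m n : (0 < d)%N -> exists s : finperm, s =1 block_swap d m n.
Proof.
move=> d0; apply: (@finperm_of_involution _ ((maxn m n).+1 * d)).
  exact: block_swapK.
move=> i; rewrite -leq_divRL // gtn_max => /andP[mi ni].
by rewrite /block_swap !gtn_eqF.
Qed.

Definition bswap d m n : finperm := xget (1%g) [set s : finperm | s =1 block_swap d m n].

Lemma bswapE d m n i : (0 < d)%N -> bswap d m n i = block_swap d m n i.
Proof.
move=> d0; rewrite /bswap; case: xgetP => [s -> //|ns].
by have [s /ns] := @bswap_exists d m n d0.
Qed.

Section Blocks.
Variables (G : groupType) (d : nat).
Hypothesis d0 : (0 < d)%N.
Variable g : wreath G.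
Hypothesis gd : forall i, wsupp g i -> (i < d)%N.

(** For [g] supported in the first block, its copy supported in the n-th
    one. *)
Definition wblock n : wreath G := wconj (bswap d 0 n) g.

Lemma bswap0E n i : (i < d)%N -> bswap d 0 n i = (n * d + i)%N.
Proof. by move=> id; rewrite bswapE // /block_swap divn_small // modn_small. Qed.

Lemma wsupp_block n i : wsupp (wblock n) i -> (i %/ d = n)%N.
Proof.
move=> /wsupp_conj/gd; set j := (_ i) => jd.
have -> : i = bswap d 0 n j by rewrite /j finpermKV.
by rewrite bswap0E // divnMDl // divn_small // addn0.
Qed.

Lemma wblock_disjointl (w : wreath G) k n : (forall i, wsupp w i -> (i < k)%N) ->
  (k <= n)%N -> wdisjoint w (wblock n).
Proof.
move=> wk kn i /wk ik /wsupp_block iN; move: kn; rewrite -iN leqNgt => /negP; apply.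
by apply: leq_ltn_trans ik; exact: leq_div.
Qed.

Lemma wconj_swap m n : wconj (bswap d m n) (wblock m) = wblock n.
Proof.
rewrite /wblock wconj_comp; apply: wconj_eq => i /gd id.
rewrite finpermM !bswap0E // bswapE // /block_swap divnMDl // divn_small //.
by rewrite addn0 eqxx modnMDl modn_small.
Qed.

Lemma wconj_swap_id m n l : l <> m -> l <> n ->
  wconj (bswap d m n) (wblock l) = wblock l.
Proof.
move=> /eqP/negPf lm /eqP/negPf ln; rewrite /wblock wconj_comp; apply: wconj_eq => i /gd id.
rewrite finpermM !bswap0E // bswapE // /block_swap divnMDl // divn_small //.
by rewrite addn0 lm ln.
Qed.

Lemma wconj_swap_far (w : wreath G) k m n : (forall i, wsupp w i -> (i < k)%N) ->
  (k <= m)%N -> (k <= n)%N -> wconj (bswap d m n) w = w.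
Proof.
move=> wk km kn; apply: wconj_id => i /wk ik; rewrite bswapE // /block_swap.
have idk : (i %/ d < k)%N by apply: leq_ltn_trans ik; exact: leq_div.
by rewrite !ltn_eqF // (leq_trans idk).
Qed.

End Blocks.

Section Central.
Variables (R : realType) (G : groupType) (phi : wreath G -> R[i]).
Hypothesis central_phi : Sinf_central phi.

Lemma central_conj s g : phi (wconj s g) = phi g.
Proof. by rewrite /wconj central_phi mulgA -wpermM mulVg mul1g. Qed.

Variables (d : nat) (g : wreath G) (k : nat) (w : wreath G).
Hypotheses (d0 : (0 < d)%N) (gd : forall i, wsupp g i -> (i < d)%N).
Hypothesis wk : forall i, wsupp w i -> (i < k)%N.
Local Notation gb := (wblock d g).

(** The copies are exchangeable: swapping two blocks far from the support of
    [w] fixes [w] and every copy in a third block. Both indices are changed one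
    at a time, through an index r different from all the others. *)
Lemma central_block2 m n p q : (k <= m)%N -> (k <= n)%N -> (k <= p)%N ->
  (k <= q)%N -> m <> n -> p <> q ->
  phi (w * ((gb m)^-1 * gb n))%g = phi (w * ((gb p)^-1 * gb q))%g.
Proof.
have one a b c : (k <= b)%N -> (k <= c)%N -> a <> b -> a <> c ->
    phi (w * ((gb a)^-1 * gb b))%g = phi (w * ((gb a)^-1 * gb c))%g.
  move=> kb kc ab ac; rewrite -(central_conj (bswap d b c)) wconj_mulVM.
  by rewrite wconj_swap // wconj_swap_id // (wconj_swap_far d0 wk).
have two a b c : (k <= b)%N -> (k <= c)%N -> a <> b -> a <> c ->
    phi (w * ((gb b)^-1 * gb a))%g = phi (w * ((gb c)^-1 * gb a))%g.
  move=> kb kc ab ac; rewrite -(central_conj (bswap d b c)) wconj_mulVM.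
  by rewrite wconj_swap // wconj_swap_id // (wconj_swap_far d0 wk).
move=> km kn kp kq mn pq.
have [r [kr mr rm rp pr]] : exists r, [/\ (k <= r)%N, m <> r, r <> m, r <> p & p <> r].
  by exists (m + p + k).+1; split; lia.
by rewrite (one _ _ _ kn kr mn mr) (two _ _ _ km kp rm rp) (one _ _ _ kr kq pr pq).
Qed.

End Central.

(** * Products over generalized cycles *)

Section Orbits.
Implicit Types (s t : finperm) (i j k : nat) (S : set nat).

Lemma porbit_of_refl s i : porbit_of s i i.
Proof. by exists 0%N; left; rewrite expg0 finperm1E. Qed.

Lemma stable_expg s S : (forall i, S (s i) <-> S i) ->
  forall n i, S ((s ^+ n)%g i) <-> S i.
Proof.
move=> sS; elim=> [|n IH] i; first by rewrite expg0 finperm1E.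
by rewrite expgS finpermM; split=> [/sS/IH|/IH/sS].
Qed.

Lemma porbit_of_sub s S i : (forall j, S (s j) <-> S j) -> S i ->
  porbit_of s i `<=` S.
Proof.
move=> sS Si j [n [->|ij]]; first by apply/(stable_expg sS).
by apply/(stable_expg sS n); rewrite -ij.
Qed.

Lemma porbit_of_eq s i j : porbit_of s i j -> porbit_of s j = porbit_of s i.
Proof.
have sub k l : porbit_of s k l -> porbit_of s l `<=` porbit_of s k.
  exact: porbit_of_sub (porbit_of_stable s k).
move=> ij; apply/seteqP; split; first exact: sub.
by apply: sub; case: ij => n [H|H]; exists n; [right|left].
Qed.

(** Two permutations that agree on a common invariant set have the same orbits
    there. *)
Lemma porbit_of_eq_on s t S i : (forall j, S (s j) <-> S j) ->
  (forall j, S (t j) <-> S j) -> (forall j, S j -> s j = t j) -> S i ->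
  porbit_of s i = porbit_of t i.
Proof.
have sub (u v : finperm) : (forall j, S (u j) <-> S j) -> (forall j, S j -> u j = v j) ->
    S i -> porbit_of u i `<=` porbit_of v i.
  move=> uS uv Si.
  have pow n j : S j -> (u ^+ n)%g j = (v ^+ n)%g j.
    move=> Sj; elim: n => [|n IH]; first by rewrite !expg0 finperm1E.
    by rewrite !expgS !finpermM -IH uv //; apply/(stable_expg uS).
  move=> j ij; have Sj := porbit_of_sub uS Si ij.
  by case: ij => n [H|H]; exists n; [left|right]; rewrite -pow.
move=> sS tS st Si; apply/seteqP; split; first exact: sub.
by apply: sub => // j Sj; rewrite st.
Qed.

End Orbits.

Section CycleProduct.
Variables (R : realType) (G : groupType).
Implicit Types (g h : wreath G) (p : set nat).

Lemma gcycleE1 g p i : porbits_of g.1 p ->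
  (gcycle g p).1 i = if i \in p then g.1 i else i.
Proof. by move=> gp; rewrite wreathM1 finperm1E finperm_restrE. Qed.

Lemma gcycleE2 g p i : (gcycle g p).2 i = if i \in p then g.2 i else 1%g.
Proof. by rewrite wreathM2 finseq1E mul1g finseq_restrE. Qed.

(** The orbits that meet the support: the only ones with a nontrivial cycle,
    and finitely many, unlike the set of all orbits. *)
Definition supp_orbits g : set (set nat) := porbit_of g.1 @` wsupp g.

Lemma finite_wsupp g : finite_set (wsupp g).
Proof.
have [n gn] := wsupp_bounded g.
by apply: sub_finite_set (finite_II n) => i /gn.
Qed.

Lemma finite_supp_orbits g : finite_set (supp_orbits g).
Proof. exact/finite_image/finite_wsupp. Qed.

Lemma supp_orbits_porbits g : supp_orbits g `<=` porbits_of g.1.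
Proof. by move=> p [i _ <-]; exists i. Qed.

Lemma supp_orbit_sub g p : supp_orbits g p -> p `<=` wsupp g.
Proof. by move=> [i gi <-]; apply: porbit_of_sub gi => j; exact: wsupp_stable. Qed.

Lemma supp_orbit_nonempty g p : supp_orbits g p -> exists i, p i.
Proof. by move=> [i gi <-]; exists i; exact: porbit_of_refl. Qed.

Lemma gcycle_off_supp g p : porbits_of g.1 p -> ~ supp_orbits g p ->
  gcycle g p = 1%g.
Proof.
move=> gp gNp; have H i : i \in p -> g.1 i = i /\ g.2 i = 1%g.
  rewrite inE => pi; apply: wsuppN => gi; apply: gNp; exists i => //.
  by case: gp pi => k _ <- /porbit_of_eq.
apply: wreathP => i; rewrite ?gcycleE1 ?gcycleE2 ?wreath1_1 ?wreath1_2 //.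
  by case: ifPn => // /H[].
by case: ifPn => // /H[].
Qed.

Section Product.
Variable F : wreath G -> R[i].
Hypothesis F1 : F 1%g = 1.

Definition cycle_prod g : R[i] :=
  \big[*%R/1]_(p \in porbits_of g.1) F (gcycle g p).

Lemma cycle_prodE g :
  cycle_prod g = \big[*%R/1]_(p \in supp_orbits g) F (gcycle g p).
Proof.
apply/esym/fsbig_widen; first exact: supp_orbits_porbits.
by move=> p [gp gNp] /=; rewrite gcycle_off_supp.
Qed.

Lemma cycle_prod1 : cycle_prod 1%g = 1.
Proof. by rewrite cycle_prodE /supp_orbits wsupp1 image_set0 fsbig_set0. Qed.

Lemma wsupp_stable_mul g h : wdisjoint g h ->
  forall i, wsupp g ((g * h)%g.1 i) <-> wsupp g i.
Proof.
move=> gh i; have [H1 H2] := wdisjoint_mulE i gh.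
have [gi|gi] := pselect (wsupp g i).
  by have [-> _] := H1 gi; split=> // _; apply/wsupp_stable.
have [-> _] := H2 gi; split=> // ghi.
by have hi := gh _ ghi; move: ghi; rewrite (wsuppN (_ : ~ wsupp h i)).1 // => /wsupp_stable.
Qed.

Lemma porbit_mul g h i : wdisjoint g h -> wsupp g i ->
  porbit_of (g * h)%g.1 i = porbit_of g.1 i.
Proof.
move=> gh gi; apply: (@porbit_of_eq_on _ _ (wsupp g)) => //.
- exact: wsupp_stable_mul.
- exact: wsupp_stable.
- by move=> j gj; have [/(_ gj)[-> _] _] := wdisjoint_mulE j gh.
Qed.

Lemma supp_orbits_mul g h : wdisjoint g h ->
  supp_orbits (g * h)%g = supp_orbits g `|` supp_orbits h.
Proof.
move=> gh; have hg := wdisjoint_sym gh.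
rewrite /supp_orbits wsuppM_disjoint // image_setU; congr (_ `|` _).
  by apply: eq_imagel => i gi; rewrite porbit_mul.
by apply: eq_imagel => i hi; rewrite wdisjoint_comm // porbit_mul.
Qed.

Lemma gcycle_mul g h p : wdisjoint g h -> supp_orbits g p ->
  gcycle (g * h)%g p = gcycle g p.
Proof.
move=> gh gp; have ghp : porbits_of (g * h)%g.1 p.
  by apply: supp_orbits_porbits; rewrite supp_orbits_mul //; left.
have H i : i \in p -> (g * h)%g.1 i = g.1 i /\ (g * h)%g.2 i = g.2 i.
  rewrite inE => /(supp_orbit_sub gp) gi.
  by have [/(_ gi)] := wdisjoint_mulE i gh.
have gp' := supp_orbits_porbits gp.
apply: wreathP => i; rewrite ?gcycleE1 ?gcycleE2 //.
  by case: ifPn => // /H[].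
by case: ifPn => // /H[].
Qed.

(** For disjoint supports the orbits of the product are those of the factors,
    with the same cycles. So the right-hand side of the product formula is
    multiplicative whatever [F] is: this is the implication from the product
    formula to multiplicativity. *)
Lemma cycle_prodM g h : wdisjoint g h ->
  cycle_prod (g * h)%g = cycle_prod g * cycle_prod h.
Proof.
move=> gh; rewrite !cycle_prodE supp_orbits_mul // fsbigU0; try exact: finite_supp_orbits.
  congr (_ * _); apply: eq_fsbigr => p /set_mem gp; first by rewrite gcycle_mul.
  by rewrite wdisjoint_comm // gcycle_mul //; exact: wdisjoint_sym.
move=> p [gp hp]; have [i pi] := supp_orbit_nonempty gp.
exact: gh (supp_orbit_sub gp pi) (supp_orbit_sub hp pi).
Qed.

Lemma gcycle_split g i : wsupp g i -> let c := gcycle g (porbit_of g.1 i) in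
  exists2 h, g = (c * h)%g & [/\ wdisjoint c h, wsupp c i & cycle_prod c = F c].
Proof.
move=> gi c; set p := porbit_of g.1 i in c *.
have gp : supp_orbits g p by exists i.
have gp' := supp_orbits_porbits gp.
have pg := supp_orbit_sub gp.
have cp j : p j -> c.1 j = g.1 j /\ c.2 j = g.2 j.
  by move=> /mem_set pj; rewrite gcycleE1 // gcycleE2 pj.
have cNp j : ~ p j -> c.1 j = j /\ c.2 j = 1%g.
  by move=> npj; rewrite gcycleE1 // gcycleE2 memNset.
have suppc : wsupp c = p.
  apply/seteqP; split=> j; last first.
    by move=> pj; have [e1 e2] := cp _ pj; have := pg _ pj; rewrite /wsupp /= e1 e2.
  by apply: contraPP => /cNp[c1 c2] [].
have hE : g = (c * (c^-1 * g))%g by rewrite mulgA mulgV mul1g.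
exists (c^-1 * g)%g => //; set h := (c^-1 * g)%g in hE *.
have h1 j : p j -> h.1 j = j.
  move=> pj; apply: (bij_inj (finperm_bij c.1)).
  by rewrite -wreathM1 -hE (cp _ pj).1.
split.
- move=> j; rewrite suppc => pj; case=> hj; apply: hj; first exact: h1.
  have := congr1 (fun x : wreath G => x.2 j) hE; rewrite wreathM2 (h1 _ pj) (cp _ pj).2.
  by rewrite -[LHS]mulg1 => /mulgI.
- by rewrite suppc; exact: porbit_of_refl.
have pcE j : p j -> porbit_of c.1 j = p.
  move=> pj; rewrite (@porbit_of_eq_on _ g.1 p) //; first exact: porbit_of_eq.
  - by move=> k; rewrite -suppc; exact: wsupp_stable.
  - exact: porbit_of_stable.
  - by move=> k /cp[].
have suppoc : supp_orbits c = [set p].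
  apply/seteqP; split=> [q [j]|q ->]; first by rewrite suppc => /pcE-> <-.
  by exists i; rewrite ?suppc ?pcE //; exact: porbit_of_refl.
rewrite cycle_prodE suppoc fsbig_set1; congr F.
have cporb : porbits_of c.1 p by apply: supp_orbits_porbits; rewrite suppoc.
apply: wreathP => j; rewrite ?gcycleE1 ?gcycleE2 //.
  by case: (j \in p).
by case: (j \in p).
Qed.

(** Induction on the cardinality of the support, a cycle being split off at
    each step. *)
Lemma multiplicative_cycle_prod :
  (forall g h, wdisjoint g h -> F (g * h)%g = F g * F h) ->
  forall g, F g = cycle_prod g.
Proof.
move=> FM g; have [n] := ubnP (#|` fset_set (wsupp g)|)%fset.
elim: n g => // n IH g gn.
have [/wsupp_eq0 ->|/set0P[i gi]] := eqVneq (wsupp g) set0.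
  by rewrite F1 cycle_prod1.
have [h gE [ch ci cF]] := gcycle_split gi; move: gE ch ci cF; set c := gcycle _ _.
move=> gE ch ci cF; rewrite gE FM // cycle_prodM // cF (IH h) //.
apply: leq_trans _ (ltnSE gn).
have supph k : (k \in fset_set (wsupp h)) = (k \in wsupp h).
  by rewrite in_fset_set //; exact: finite_wsupp.
have suppg k : (k \in fset_set (wsupp g)) = (k \in wsupp g).
  by rewrite in_fset_set //; exact: finite_wsupp.
apply: fproper_ltn_card; rewrite fproperE; apply/andP; split.
  apply/fsubsetP => k; rewrite supph suppg !inE => hk.
  by rewrite gE wsuppM_disjoint //; right.
apply/negP => /fsubsetP/(_ i); rewrite supph suppg !inE => /(_ gi).
exact: ch.
Qed.

End Product.

Lemma multiplicative_iff_cycle_prod (phi : wreath G -> R[i]) : phi 1%g = 1 ->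
  (forall g g', wsupp g `&` wsupp g' = set0 -> phi (g * g')%g = phi g * phi g') <->
  (forall g, phi g = \big[*%R/1]_(p \in porbits_of g.1) phi (gcycle g p)).
Proof.
move=> phi1; split=> [H|H g g' gg'].
  apply: multiplicative_cycle_prod => // g h gh; apply: H.
  by apply/seteqP; split=> // i [/gh].
have gh : wdisjoint g g'.
  by move=> i gi g'i; have : (wsupp g `&` wsupp g') i by []; rewrite gg'.
by rewrite !H; exact: cycle_prodM.
Qed.

End CycleProduct.

(** * Means of vectors with constant inner products *)

Section HilbertTheory.
Variables (R : realType) (H : hilbertType R).
Local Notation C := R[i].
Local Notation "''[' x , y ]" := (inner H x y) : ring_scope.
Implicit Types (x y z : H) (a : C) (u v : nat -> H).

Lemma innerDl x y z : '[x + y, z] = '[x, z] + '[y, z].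
Proof. exact: linearDl. Qed.
Lemma innerZl a x z : '[a *: x, z] = a * '[x, z].
Proof. exact: linearZl_LR. Qed.
Lemma innerC x y : '[y, x] = '[x, y]^*.
Proof. by rewrite (@hermitian_subproof _ _ _ _ (inner H)) expr0 mul1r. Qed.
Lemma innerDr x y z : '[z, x + y] = '[z, x] + '[z, y].
Proof. by rewrite innerC innerDl rmorphD /= -!innerC. Qed.
Lemma innerZr a x z : '[z, a *: x] = a^* * '[z, x].
Proof. by rewrite innerC innerZl rmorphM /= -innerC. Qed.
Lemma innerNl x z : '[- x, z] = - '[x, z].
Proof. by rewrite -scaleN1r innerZl mulN1r. Qed.
Lemma innerNr x z : '[z, - x] = - '[z, x].
Proof. by rewrite innerC innerNl rmorphN /= -innerC. Qed.
Lemma innerBl x y z : '[x - y, z] = '[x, z] - '[y, z].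
Proof. by rewrite innerDl innerNl. Qed.
Lemma innerBr x y z : '[z, x - y] = '[z, x] - '[z, y].
Proof. by rewrite innerDr innerNr. Qed.
Lemma inner0l z : '[0, z] = 0.
Proof. by rewrite -(scale0r z) innerZl mul0r. Qed.
Lemma inner0r z : '[z, 0] = 0.
Proof. by rewrite innerC inner0l rmorph0. Qed.
Lemma inner_suml (I : Type) (r : seq I) (P : pred I) (F : I -> H) z :
  '[\sum_(i <- r | P i) F i, z] = \sum_(i <- r | P i) '[F i, z].
Proof. exact: (big_morph (fun x => '[x, z]) (fun x y => innerDl x y z) (inner0l z)). Qed.
Lemma inner_sumr (I : Type) (r : seq I) (P : pred I) (F : I -> H) z :
  '[z, \sum_(i <- r | P i) F i] = \sum_(i <- r | P i) '[z, F i].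
Proof. exact: (big_morph (fun x => '[z, x]) (fun x y => innerDr x y z) (inner0r z)). Qed.

Lemma inner_le x y : `|'[x, y]| <= `|x| * `|y|.
Proof.
rewrite -ler_sqr ?nnegrE ?mulr_ge0 // exprMn.
apply: disc_bound; rewrite ?exprn_ge0 // => l.
suff -> : `|x| ^+ 2 + l^* * '[x, y] + l * '[x, y]^* + `|l| ^+ 2 * `|y| ^+ 2 =
  `|x + l *: y| ^+ 2 by rewrite exprn_ge0.
rewrite -!innerxx innerDl !innerDr !innerZl !innerZr -(innerC x y) normCK; ring.
Qed.

Lemma normB2 x y : `|x - y| ^+ 2 = '[x, x] - '[x, y] - '[y, x] + '[y, y].
Proof. by rewrite -innerxx innerBl !innerBr; ring. Qed.

Definition cauchy_sequence u := forall e : C, 0 < e ->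
  exists N, forall k l, (N <= k)%N -> (N <= l)%N -> `|u k - u l| <= e.

Lemma cauchy_sequence_cvg u : cauchy_sequence u -> cvgn u.
Proof.
move=> uc; apply: cauchy_cvg; apply/cauchyP => e e0.
have e20 : 0 < e / 2 by rewrite divr_gt0.
have [N uN] := uc _ e20; exists (u N); exists N => // k /= Nk.
rewrite -ball_normE /=; apply: le_lt_trans (uN _ _ (leqnn _) Nk) _.
by rewrite ltr_pdivrMr // mulr_natr mulr2n ltrDl.
Qed.

Lemma dense_near (D : set H) x (e : C) : closure D = setT -> 0 < e ->
  exists2 y, D y & `|x - y| < e.
Proof.
move=> Dd e0; have : closure D x by rewrite Dd.
move=> /(_ (ball x e))[|y [Dy]]; first exact: nbhsx_ballx.
by rewrite -ball_normE => ?; exists y.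
Qed.

Lemma cvg_inner_const u x y (z : C) : u @ \oo --> x ->
  (\forall k \near \oo, '[u k, y] = z) -> '[x, y] = z.
Proof.
move=> ux uz; apply/eqP; rewrite -subr_eq0 -normr_le0; apply/ler_addgt0Pl => e e0.
have y1 : 0 < `|y| + 1 by rewrite ltr_wpDl.
have : \forall k \near \oo, `|x - u k| < e / (`|y| + 1).
  by move/cvgrPdist_lt: ux; apply; rewrite divr_gt0.
move=> /(filterI uz)/filter_ex[k [<- /= h]].
rewrite -innerBl addr0 (le_trans (inner_le _ _)) //.
move: h; rewrite ltr_pdivlMr // => /ltW; apply: le_trans.
by rewrite ler_wpM2l // lerDl.
Qed.

Lemma contraction_continuous (T : H -> H) : linear T ->
  (forall x, `|T x| <= `|x|) -> continuous T.
Proof.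
move=> Tl Tc x; apply/cvgrPdist_lt => e e0.
apply/nbhs_normP; exists e => // y /=; apply: le_lt_trans.
have -> : T x - T y = T (x - y).
  by rewrite addrC -scaleN1r -Tl scaleN1r addrC.
exact: Tc.
Qed.

(** The mean of the terms of index [k * k], ..., [k * k + k]. The windows of
    different indices are disjoint, and since [k <= k * k] they move off to
    infinity. *)
Definition window_mean v k : H :=
  k.+1%:R^-1 *: \sum_(j < k.+1) v (k * k + j)%N.

Lemma window_disjoint k l i j : (k < l)%N -> (i < k.+1)%N -> (k * k + i)%N <> (l * l + j)%N.
Proof. by move=> kl ik; nia. Qed.

Let succ_neq0 m : m.+1%:R != 0 :> C. Proof. by rewrite pnatr_eq0. Qed.

Section WindowMean.
Variables (v : nat -> H) (K : nat) (c d : C).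
Hypothesis vc : forall m n, (K <= m)%N -> (K <= n)%N -> m <> n -> '[v n, v m] = c.
Hypothesis vd : forall n, '[v n, v n] = d.

Lemma window_mean_inner k l : (K <= k)%N -> (K <= l)%N -> k <> l ->
  '[window_mean v k, window_mean v l] = c.
Proof.
move=> Kk Kl kl.
have E (i : 'I_k.+1) (j : 'I_l.+1) : '[v (k * k + i)%N, v (l * l + j)%N] = c.
  apply: vc; [nia|nia|].
  case: (ltngtP k l) => // kl'; last exact: window_disjoint.
  by apply/nesym/window_disjoint.
rewrite innerZl innerZr inner_suml.
under eq_bigr do rewrite inner_sumr (eq_bigr _ (fun j _ => E _ j)) sumr_const card_ord.
rewrite sumr_const card_ord -(mulr_natr c) -(mulr_natr (c * _)).
rewrite geC0_conj ?invr_ge0 //.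
move: (succ_neq0 k) (succ_neq0 l).
by move: (k.+1%:R) (l.+1%:R) => p q p0 q0; field; rewrite p0 q0.
Qed.

Lemma window_mean_innerxx k : (K <= k)%N ->
  '[window_mean v k, window_mean v k] = c + (d - c) / k.+1%:R.
Proof.
move=> Kk.
have E (i j : 'I_k.+1) : '[v (k * k + i)%N, v (k * k + j)%N] = c + (d - c) *+ (i == j).
  case: eqVneq => [->|ij]; first by rewrite vd mulr1n addrC subrK.
  rewrite mulr0n addr0; apply: vc; [nia|nia|].
  by move=> /addnI/ord_inj /eqP; rewrite eq_sym (negPf ij).
rewrite innerZl innerZr inner_suml.
under eq_bigr => i _.
  rewrite inner_sumr (eq_bigr _ (fun j _ => E i j)) big_split /= sumr_const card_ord.
  over.
rewrite big_split /= sumr_const card_ord.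
have -> : \sum_(i < k.+1) \sum_(j < k.+1) (d - c) *+ (i == j) = (d - c) *+ k.+1.
  rewrite -[in RHS](card_ord k.+1) -sumr_const; apply: eq_bigr => i _.
  by rewrite (bigD1 i) //= eqxx big1 ?addr0 // => j /negPf; rewrite eq_sym => ->.
rewrite -(mulr_natr c) -(mulr_natr (c * _)) -(mulr_natr (d - c)).
rewrite geC0_conj ?invr_ge0 //.
by move: (succ_neq0 k); move: (k.+1%:R) => p p0; field; rewrite p0.
Qed.

(** Distinct means have inner product c, and the squared norm of the k-th one is
    [c + (d - c) / (k + 1)]; hence the squared distance between the k-th and the
    l-th is [(d - c) (1 / (k + 1) + 1 / (l + 1))]. *)
Lemma window_mean_cauchy : cauchy_sequence (window_mean v).
Proof.
move=> e e0; pose b := `|d - c| * 2 / e ^+ 2.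
have b0 : 0 <= b by apply: divr_ge0; [exact: mulr_ge0|rewrite exprn_ge0 // ltW].
have bE : b = (complex.Re b)%:C%C by rewrite RRe_real // ger0_real.
(* With [b <= N + 1], the squared distance of means of index at least N is at
   most [2 |d - c| / (N + 1) <= e ^ 2]. *)
pose N := (K + Num.bound (complex.Re b))%N.
have bN : b <= N.+1%:R.
  rewrite bE -(rmorph_nat (real_complex R)) lecR ltW //.
  have /archi_boundP : 0 <= complex.Re b by rewrite -lecR -bE.
  by move=> /lt_le_trans; apply; rewrite ler_nat /N; lia.
exists N => k l Nk Nl; have [->|/eqP kl] := eqVneq k l.
  by rewrite subrr normr0 ltW.
have Kk : (K <= k)%N by rewrite /N in Nk; lia.
have Kl : (K <= l)%N by rewrite /N in Nl; lia.
rewrite -ler_sqr ?nnegrE ?(ltW e0) //.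
set X := `|_| ^+ 2.
have XE : X = (d - c) * (k.+1%:R^-1 + l.+1%:R^-1).
  rewrite /X normB2 !window_mean_innerxx // !window_mean_inner //; last exact: nesym.
  ring.
have e2 : 0 < e ^+ 2 by rewrite exprn_gt0.
have N0 : 0 < N.+1%:R :> C by rewrite ltr0n.
have s_le m : (N <= m)%N -> m.+1%:R^-1 <= N.+1%:R^-1 :> C.
  by move=> Nm; rewrite lef_pV2 ?posrE ?ltr0n // ler_nat.
have X0 : 0 <= X by rewrite /X exprn_ge0.
rewrite -(ger0_norm X0) XE normrM.
rewrite [X in _ * X]ger0_norm ?addr_ge0 ?invr_ge0 //.
apply: (@le_trans _ _ (`|d - c| * (N.+1%:R^-1 + N.+1%:R^-1))).
  by rewrite ler_wpM2l // lerD // s_le.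
have -> : `|d - c| * (N.+1%:R^-1 + N.+1%:R^-1) = `|d - c| * 2 / N.+1%:R by ring.
by rewrite ler_pdivrMr // [leRHS]mulrC -ler_pdivrMr.
Qed.

End WindowMean.
End HilbertTheory.

(** * Factors give multiplicative states *)

Section UnitaryRep.
Variables (R : realType) (H : hilbertType R) (G : groupType).
Local Notation C := R[i].
Local Notation "''[' x , y ]" := (inner H x y) : ring_scope.
Variable rho : G -> H -> H.
Hypothesis rho_unitary : unitary_rep rho.
Implicit Types (x y z : H) (g h : G).

Lemma rho_linear g : linear (rho g). Proof. by case: rho_unitary. Qed.

Lemma rho_inner g x y : '[rho g x, rho g y] = '[x, y].
Proof. by case: rho_unitary. Qed.

Lemma rho1 x : rho 1%g x = x. Proof. by case: rho_unitary => _ _ ->. Qed.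

Lemma rhoM g h x : rho (g * h)%g x = rho g (rho h x).
Proof. by case: rho_unitary => _ _ _ ->. Qed.

Lemma rho_norm g x : `|rho g x| = `|x|.
Proof.
by apply/eqP; rewrite -(@eqrXn2 _ 2) // -!innerxx rho_inner.
Qed.

Lemma rho_bounded g : bounded_operators (rho g).
Proof.
split; first exact: rho_linear.
by apply: contraction_continuous (rho_linear g) _ => x; rewrite rho_norm.
Qed.

Lemma rho_adj g x y : '[rho g x, y] = '[x, rho g^-1%g y].
Proof. by rewrite -(rho_inner g^-1) -rhoM mulVg rho1. Qed.

End UnitaryRep.

(** The operators in the definition of von Neumann algebras are bare functions
    with a proof of linearity, hence these variants of the usual rules. *)
Lemma raw_linear_sum (K : nzRingType) (U V : lmodType K) (T : U -> V) (I : Type)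
    (r : seq I) (F : I -> U) : linear T ->
  T (\sum_(i <- r) F i) = \sum_(i <- r) T (F i).
Proof.
move=> Tl; have T0 : T 0 = 0.
  by have := Tl (-1) 0 0; rewrite scaleN1r addr0 oppr0 scaleN1r addNr.
by apply: (big_morph T) => // x y; have := Tl 1 x y; rewrite !scale1r.
Qed.

Lemma raw_linearZ (K : nzRingType) (U V : lmodType K) (T : U -> V) a x :
  linear T -> T (a *: x) = a *: T x.
Proof.
move=> Tl; have T0 : T 0 = 0.
  by have := Tl (-1) 0 0; rewrite scaleN1r addr0 oppr0 scaleN1r addNr.
by have := Tl a x 0; rewrite T0 !addr0.
Qed.

Lemma raw_linearB (K : nzRingType) (U V : lmodType K) (T : U -> V) x y :
  linear T -> T (x - y) = T x - T y.
Proof. by move=> Tl; rewrite addrC -scaleN1r Tl scaleN1r addrC. Qed.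

Lemma wdisjoint_mulVM (G : groupType) (x y a b : wreath G) :
  wdisjoint x b -> wdisjoint y b ->
  ((x * a)^-1 * (y * b) = (a^-1 * b) * (x^-1 * y))%g.
Proof.
move=> xb yb; rewrite invgM -!mulgA; congr (_ * _)%g; rewrite [LHS]mulgA.
by apply: wdisjoint_comm; apply: wdisjointM => //; exact: wdisjointV.
Qed.

Section AsymptoticOperator.
Variables (R : realType) (H : hilbertType R) (G : groupType).
Local Notation C := R[i].
Local Notation "''[' x , y ]" := (inner H x y) : ring_scope.
Variables (phi : wreath G -> C) (rho : wreath G -> H -> H) (xi : H).
Hypothesis central_phi : Sinf_central phi.
Hypothesis gns : GNS_triple phi rho xi.
Variables (d : nat) (g : wreath G).
Hypotheses (d0 : (0 < d)%N) (gd : forall i, wsupp g i -> (i < d)%N).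
Local Notation gb := (wblock d g).
Implicit Types (x y z : H) (h w : wreath G).

Let rho_unitary : unitary_rep rho. Proof. by case: gns. Qed.
Let rl := rho_linear rho_unitary.

Lemma gns_cyclic : closure (orbit_span rho xi) = setT.
Proof. by case: gns. Qed.

Lemma phi_inner h w : '[rho h xi, rho w xi] = phi (w^-1 * h)%g.
Proof.
case: gns => _ _ ->; rewrite (rhoM rho_unitary) [RHS](rho_adj rho_unitary).
by rewrite invgK.
Qed.

(** The means of the operators [rho (gb n)] converge strongly because the copies
    [gb n] are exchangeable; their limit plays the role of a weak limit point of
    the operators themselves. *)
Definition block_mean k x : H := window_mean (fun n => rho (gb n) x) k.

Lemma block_mean_linear k : linear (block_mean k).
Proof.
move=> a x y; rewrite /block_mean /window_mean.
under eq_bigr do rewrite rl.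
by rewrite big_split /= -scaler_sumr scalerDr !scalerA mulrC.
Qed.

Lemma block_mean_norm k x : `|block_mean k x| <= `|x|.
Proof.
rewrite /block_mean /window_mean normrZ ger0_norm ?invr_ge0 //.
rewrite mulrC ler_pdivrMr ?ltr0n // (le_trans (ler_norm_sum _ _ _)) //.
under eq_bigr do rewrite (rho_norm rho_unitary).
by rewrite sumr_const card_ord mulr_natr.
Qed.

Lemma supp_block_comm h k : (forall i, wsupp h i -> (i < k)%N) ->
  forall n, (k <= n)%N -> (gb n * h = h * gb n)%g.
Proof. by move=> hk n kn; apply/esym/wdisjoint_comm/(wblock_disjointl d0 gd hk). Qed.

(** An element [h] commutes with all but finitely many copies, and the windows
    move off to infinity. *)
Lemma block_mean_comm h : exists K, forall k, (K <= k)%N ->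
  forall x, block_mean k (rho h x) = rho h (block_mean k x).
Proof.
have [K hK] := wsupp_bounded h; exists K => k Kk x.
rewrite /block_mean /window_mean (raw_linearZ _ _ (rl h)) (raw_linear_sum _ _ (rl h)).
congr (_ *: _); apply: eq_bigr => j _; rewrite -!(rhoM rho_unitary).
by rewrite (supp_block_comm hK) //; nia.
Qed.

(** By sesquilinearity this reduces to vectors [rho h xi], where the inner
    product is a value of [phi] to which [central_block2] applies once the
    copies are moved past the elements h. *)
Lemma block_inner_const x : orbit_span rho xi x ->
  exists K c, forall m n, (K <= m)%N -> (K <= n)%N -> m <> n ->
    '[rho (gb n) x, rho (gb m) x] = c.
Proof.
move=> [p [a [h ->]]].
have [K hK] : exists K, forall j i, wsupp (h j) i -> (i < K)%N.
  have [f fP] := choice (fun j => wsupp_bounded (h j)).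
  exists (\max_j f j) => j i /fP/leq_trans; apply; exact: leq_bigmax.
pose I n m := '[rho (gb n) (\sum_(i < p) a i *: rho (h i) xi),
   rho (gb m) (\sum_(i < p) a i *: rho (h i) xi)].
exists K, (I K.+1 K) => m n Km Kn mn; rewrite /I.
rewrite !(raw_linear_sum _ _ (rl _)) !inner_suml; apply: eq_bigr => i _.
rewrite !inner_sumr; apply: eq_bigr => j _.
rewrite !(raw_linearZ _ _ (rl _)) !innerZl !innerZr; congr (_ * (_ * _)).
rewrite -!(rhoM rho_unitary) !phi_inner.
have E n' m' : (K <= n')%N -> (K <= m')%N ->
    ((gb m' * h j)^-1 * (gb n' * h i) = ((h j)^-1 * h i) * ((gb m')^-1 * gb n'))%g.
  by move=> Kn' Km'; apply: wdisjoint_mulVM;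
    apply/wdisjoint_sym/(wblock_disjointl d0 gd (hK i)).
rewrite (E _ _ Kn Km) (E _ _ (leqnSn K) (leqnn K)).
apply: (central_block2 central_phi d0 gd) Km Kn (leqnn K) (leqnSn K) mn (@n_Sn K).
by move=> l /wsuppM[/wsuppV|]; exact: hK.
Qed.

(** Convergence is known on the dense span of the orbit, and the means are
    contractions. *)
Lemma block_mean_cvg x : cvgn (block_mean ^~ x).
Proof.
apply: cauchy_sequence_cvg => e e0.
have e30 : 0 < e / 3 by rewrite divr_gt0.
have [y Dy xy] := dense_near x gns_cyclic e30.
have [K [c yc]] := block_inner_const Dy.
have yd n : '[rho (gb n) y, rho (gb n) y] = '[y, y] by rewrite (rho_inner rho_unitary).
have [N HN] := window_mean_cauchy yc yd e30.
exists N => k l Nk Nl.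
have near m : `|block_mean m x - block_mean m y| <= e / 3.
  rewrite -(raw_linearB _ _ (block_mean_linear m)) (le_trans (block_mean_norm _ _)) //.
  exact: ltW.
have -> : block_mean k x - block_mean l x = (block_mean k x - block_mean k y) +
    (block_mean k y - block_mean l y) + (block_mean l y - block_mean l x).
  by rewrite !addrA !subrK.
have -> : e = e / 3 + e / 3 + e / 3 by field.
rewrite (le_trans (ler_normD _ _)) // lerD //; last by rewrite distrC.
by rewrite (le_trans (ler_normD _ _)) // lerD // HN.
Qed.

Definition asymptotic_op x : H := lim (block_mean ^~ x @ \oo).
Local Notation A := asymptotic_op.

Lemma asymptotic_cvg x : block_mean ^~ x @ \oo --> A x.
Proof. exact: block_mean_cvg. Qed.

Lemma asymptotic_unique x y : block_mean ^~ x @ \oo --> y -> A x = y.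
Proof. by move=> xy; apply: cvg_lim xy; exact: norm_hausdorff. Qed.

Lemma asymptotic_linear : linear A.
Proof.
move=> a x y; apply: asymptotic_unique.
under eq_fun do rewrite block_mean_linear.
by apply: cvgD; [apply: cvgZl_tmp|]; exact: asymptotic_cvg.
Qed.

Lemma asymptotic_norm x : `|A x| <= `|x|.
Proof.
apply/ler_addgt0Pl => e e0.
have : \forall k \near \oo, `|A x - block_mean k x| < e.
  by move/cvgrPdist_lt: (@asymptotic_cvg x); apply.
move=> /filter_ex[k h]; rewrite -[A x](subrK (block_mean k x)).
by rewrite (le_trans (ler_normD _ _)) // lerD ?(ltW h) // block_mean_norm.
Qed.

Lemma asymptotic_bounded : bounded_operators A.
Proof.
split; first exact: asymptotic_linear.
exact: contraction_continuous asymptotic_linear asymptotic_norm.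
Qed.

Lemma asymptotic_comm_rho h x : A (rho h x) = rho h (A x).
Proof.
apply: asymptotic_unique; have [K hK] := block_mean_comm h.
have rc : continuous (rho h) by case: (rho_bounded rho_unitary h).
have : rho h (block_mean k x) @[k --> \oo] --> rho h (A x).
  by apply: continuous_cvg; [exact: rc|exact: asymptotic_cvg].
apply: cvg_trans; apply: near_eq_cvg; exists K => // k /= Kk.
by rewrite hK.
Qed.

(** A bounded operator that commutes with the representation commutes with the
    means, hence with their strong limit. *)
Lemma asymptotic_vN : vN_generated (range rho) A.
Proof.
split; first exact: asymptotic_bounded.
move=> T [[Tl Tc] Trho]; apply/funext => x /=; apply: asymptotic_unique.
have : T (block_mean k x) @[k --> \oo] --> T (A x).
  by apply: continuous_cvg; [exact: Tc|exact: asymptotic_cvg].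
rewrite (_ : (fun k => T (block_mean k x)) = block_mean^~ (T x)) //.
apply/funext => k; rewrite /block_mean /window_mean raw_linearZ // raw_linear_sum //.
congr (_ *: _); apply: eq_bigr => j _.
by have /(congr1 (@^~ x)) := Trho _ (imageT rho (gb (k * k + j))).
Qed.

Lemma asymptotic_center : commutant (vN_generated (range rho)) A.
Proof.
split; first exact: asymptotic_bounded.
move=> T [_ Tcomm]; apply/esym/Tcomm; split; first exact: asymptotic_bounded.
move=> _ [h _ <-]; apply/funext => x /=; exact: asymptotic_comm_rho.
Qed.

End AsymptoticOperator.

(** Unlike [bswap d 0 n], this permutation does not move the points of the first
    block that are outside [S]. *)
Lemma finperm_move_block (S S' : set nat) d n : (0 < d)%N -> (0 < n)%N ->
  (forall i, S i -> (i < d)%N) -> (forall i, S' i -> (i < n)%N) ->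
  S `&` S' = set0 ->
  exists s : finperm, (forall i, S i -> s i = bswap d 0 n i) /\
                      (forall i, S' i -> s i = i).
Proof.
move=> d0 n0 Sd S'n SS'.
pose f i := if `[< S i >] then (n * d + i)%N
  else if (i %/ d == n)%N && `[< S (i %% d)%N >] then (i %% d)%N else i.
have fdiv r : (r < d)%N -> ((n * d + r) %/ d = n)%N /\ ((n * d + r) %% d = r)%N.
  move=> rd; rewrite divnMDl // divn_small // addn0; split=> //.
  by rewrite modnMDl modn_small.
have big i : (i %/ d == n)%N -> ~ S i.
  by move=> /eqP iN /Sd id; move: n0; rewrite -iN divn_small.
have fS i : S i -> f i = (n * d + i)%N by move=> Si; rewrite /f asboolT.
have fB i : (i %/ d == n)%N -> S (i %% d)%N -> f i = (i %% d)%N.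
  by move=> iN Si; rewrite /f asboolF ?iN ?asboolT //; exact: big.
have fO i : ~ S i -> ~ ((i %/ d == n)%N /\ S (i %% d)%N) -> f i = i.
  move=> nSi nB; rewrite /f asboolF //; case: ifPn => // /andP[iN /asboolP Si].
  by case: nB.
have fK : involutive f.
  move=> i; have [Si|nSi] := pselect (S i).
    have [h1 h2] := fdiv _ (Sd _ Si).
    by rewrite (fS _ Si) fB ?h1 ?h2.
  have [[iN Si]|nB] := pselect ((i %/ d == n)%N /\ S (i %% d)%N).
    by rewrite (fB _ iN Si) fS // -(eqP iN) -divn_eq.
  by rewrite !fO.
have [|s sE] := @finperm_of_involution f (n.+1 * d) fK.
  move=> i; rewrite -leq_divRL // => ni; rewrite /f asboolF ?gtn_eqF //.
  by move=> /Sd id; move: ni; rewrite divn_small.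
exists s; split=> i; rewrite sE /f.
  by move=> Si; rewrite asboolT // (bswap0E d0) //; exact: Sd.
move=> S'i; rewrite asboolF; last by move=> Si; have : (S `&` S') i by []; rewrite SS'.
rewrite ltn_eqF //; apply: leq_ltn_trans (S'n _ S'i); exact: leq_div.
Qed.

(** The asymptotic operator of [g'] lies in the center, so it is a scalar [c].
    For [w] with support disjoint from that of [g'], the value [phi (w * g')]
    does not change when [g'] is replaced with a far copy, so it equals the mean
    of such values, whose limit is [c * phi w]. The case [w = 1] identifies [c]
    with [phi g']. *)
Lemma indecomposable_multiplicative (R : realType) (G : groupType)
    (phi : wreath G -> R[i]) : Sinf_central phi -> phi 1%g = 1 ->
  indecomposable phi ->
  forall g g', wsupp g `&` wsupp g' = set0 -> phi (g * g')%g = phi g * phi g'.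
Proof.
move=> central_phi phi1 [H [rho [xi [gns fact]]]] g g' gg'.
have [d' g'd'] := wsupp_bounded g'; pose d := d'.+1.
have g'd i : wsupp g' i -> (i < d)%N by move=> /g'd' /leqW.
have d0 : (0 < d)%N by [].
pose A := asymptotic_op rho d g'.
have [c Ac] : exists c : R[i], A = (fun x => c *: x).
  suff : scalar_operators A by [].
  rewrite -fact; split.
    exact: (asymptotic_vN central_phi gns d0 g'd).
  exact: (asymptotic_center central_phi gns d0 g'd).
have H0 w : wsupp w `&` wsupp g' = set0 -> phi (w * g')%g = c * phi w.
  move=> wg'; have [K wK] := wsupp_bounded w.
  have [ru _ phiE] := gns; rewrite phiE [in RHS]phiE -innerZl.
  have wl := rho_linear ru w.
  rewrite -(raw_linearZ _ _ wl) -[c *: xi]/((fun x => c *: x) xi) -Ac.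
  have rc : continuous (rho w) by case: (rho_bounded ru w).
  apply/esym; apply: (@cvg_inner_const _ _ (fun k => rho w (block_mean rho d g' k xi))).
    apply: continuous_cvg; [exact: rc|].
    exact: (asymptotic_cvg central_phi gns d0 g'd).
  exists K.+1 => // k /= Kk.
  rewrite /block_mean /window_mean raw_linearZ // raw_linear_sum // innerZl inner_suml.
  under eq_bigr => j _.
    rewrite -(rhoM ru) -phiE.
    have -> : phi (w * wblock d g' (k * k + j))%g = phi (w * g')%g.
      have [|||s [sg' sw]] := @finperm_move_block (wsupp g') (wsupp w) d (k * k + j) d0 _ g'd.
      - by nia.
      - by move=> i /wK; nia.
      - by rewrite setIC.
      rewrite -[RHS](central_conj central_phi s) wconjM (wconj_id sw).
      by rewrite (wconj_eq sg').
    over.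
  have kN0 : k.+1%:R != 0 :> R[i] by rewrite pnatr_eq0.
  by rewrite sumr_const card_ord -(mulr_natr (phi _)) -phiE mulrC mulfK.
rewrite H0 // mulrC; congr (_ * _).
by have := H0 1%g; rewrite wsupp1 set0I mul1g phi1 mulr1 => ->.
Qed.

(** * Multiplicative states give factors *)

(** Writing [y] for an approximation of [v]: the squared norm of [v], which is
    the inner product of [U v] and [v], is close to that of [U y] and [y], i.e.
    to the squared modulus of the inner product of [y] and [xi], which is close
    to that of [v] and [xi]. Thus equality holds in Cauchy-Schwarz. *)
Lemma fixed_vector_line (R : realType) (H : hilbertType R) (D : set H) (xi v : H) :
  closure D = setT -> `|xi| = 1 ->
  (forall y, D y -> exists U : H -> H, [/\ linear U,
     forall x z, inner H (U x) (U z) = inner H x z, U v = v &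
     inner H (U y) y = inner H y xi * inner H xi y]) ->
  v = inner H v xi *: xi.
Proof.
move=> Dd xi1 DU; set c := inner H v xi.
suff vv : inner H v v = c * c^*.
  apply/eqP; rewrite -subr_eq0 -normr_eq0 -sqrf_eq0 normB2.
  rewrite innerZl !innerZr (innerC v xi) -/c vv innerZl innerxx xi1; apply/eqP.
  ring.
have xiv : inner H xi v = c^* by rewrite innerC.
apply/eqP; rewrite -subr_eq0 -normr_le0; apply/ler_addgt0Pl => e e0; rewrite addr0.
pose M := 2 * (2 * `|v| + 1); have M0 : 0 < M.
  by rewrite mulr_gt0 // ltr_wpDl // mulr_ge0.
(* Any [del <= 1] with [del * M <= e] would do; the four error terms add up to
   [del * M] at most. *)
pose del := e / (M + e); have Me : 0 < M + e by rewrite addr_gt0.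
have del0 : 0 < del by rewrite divr_gt0.
have del1 : del <= 1 by rewrite ler_pdivrMr // mul1r lerDr ltW.
have delM : del * M <= e.
  rewrite /del mulrAC ler_pdivrMr // ler_wpM2l ?(ltW e0) //.
  by rewrite lerDl ltW.
have [y Dy vy] := dense_near v Dd del0.
have [U [Ul Ui Uv Uy]] := DU _ Dy.
have UN x : `|U x| = `|x|.
  by apply/eqP; rewrite -(@eqrXn2 _ 2) // -!innerxx Ui.
have yv : `|y| <= `|v| + 1.
  rewrite -[y](subrK v) addrC (le_trans (ler_normD _ _)) // lerD //.
  by rewrite distrC (le_trans (ltW vy)).
have -> : inner H v v - c * c^* = (inner H (U (v - y)) v + inner H (U y) (v - y)) -
    (inner H (v - y) xi * inner H xi v + inner H y xi * inner H xi (v - y)).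
  rewrite (raw_linearB _ _ Ul) Uv !innerBl !innerBr Uy xiv -/c; ring.
have b1 : `|inner H (U (v - y)) v| <= del * `|v|.
  by rewrite (le_trans (inner_le _ _)) // UN ler_wpM2r // ltW.
have b2 : `|inner H (U y) (v - y)| <= del * (`|v| + 1).
  rewrite (le_trans (inner_le _ _)) // UN mulrC; apply: ler_pM => //; exact: ltW.
have b3 : `|inner H (v - y) xi * inner H xi v| <= del * `|v|.
  rewrite normrM; apply: ler_pM => //.
    by rewrite (le_trans (inner_le _ _)) // xi1 mulr1 ltW.
  by rewrite (le_trans (inner_le _ _)) // xi1 mul1r.
have b4 : `|inner H y xi * inner H xi (v - y)| <= del * (`|v| + 1).
  rewrite normrM mulrC; apply: ler_pM => //.
    by rewrite (le_trans (inner_le _ _)) // xi1 mul1r ltW.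
  by rewrite (le_trans (inner_le _ _)) // xi1 mulr1.
apply: le_trans delM; rewrite (le_trans (ler_normB _ _)) //.
have -> : del * M = (del * `|v| + del * (`|v| + 1)) + (del * `|v| + del * (`|v| + 1)).
  by rewrite /M; ring.
by apply: lerD; rewrite (le_trans (ler_normD _ _)) // lerD.
Qed.

Section GNS.
Variables (R : realType) (G : groupType) (phi : G -> R[i]).
Local Notation C := R[i].
Hypothesis phi_pd : positive_definite phi.

Lemma gns_kernel_ge0 (c : seq (C * G)) :
  0 <= \sum_(j <- c) j.1^* * \sum_(i <- c) i.1 * phi (j.2^-1 * i.2)%g.
Proof.
have := phi_pd (fun i : 'I_(size c) => (tnth (in_tuple c) i).2)
  (fun i => (tnth (in_tuple c) i).1).
congr (0 <= _); rewrite exchange_big /= [RHS]big_tnth.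
refine (eq_bigr _ _) => j _; rewrite mulr_sumr [RHS]big_tnth.
by refine (eq_bigr _ _) => i _; rewrite mulrCA mulrA.
Qed.

(** The kernel function of [x] is the vector [rho x xi]. *)
Definition gns_kernel : pdkernel R G :=
  @PdKernel R G (fun x y => phi (y^-1 * x)%g) gns_kernel_ge0.
Local Notation H := (rkhs_hilbert gns_kernel).

Lemma gns_kernel_mull g x y : gns_kernel (g * x)%g (g * y)%g = gns_kernel x y.
Proof. by rewrite /= invgM -!mulgA mulKg. Qed.

Definition gns_rep g : H -> H :=
  rkshift (mulVKg g) (gns_kernel_mull g).

Definition gns_vector : H := rkpoint gns_kernel 1%g.

Lemma gns_rep_point g x : gns_rep g (rkpoint gns_kernel x) = rkpoint gns_kernel (g * x)%g.
Proof. exact: rkshift_point. Qed.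

Lemma gns_rep_unitary : unitary_rep gns_rep.
Proof.
split.
- move=> g; exact: rkshift_linear.
- move=> g x y; exact: (rkshift_inner _ (mulKg g)).
- by apply/funext => f; apply/val_inj/funext => x; rewrite /= invg1 mul1g.
- by move=> g h; apply/funext => f; apply/val_inj/funext => x; rewrite /= invgM mulgA.
Qed.

Lemma rkcomb_orbit c : rkcomb gns_kernel c =
  \sum_(i < size c) (tnth (in_tuple c) i).1 *:
     gns_rep (tnth (in_tuple c) i).2 gns_vector.
Proof.
rewrite rkcombE big_tnth; apply: eq_bigr => i _.
by rewrite gns_rep_point mulg1.
Qed.

Lemma gns_exists : GNS_triple phi gns_rep gns_vector.
Proof.
split; first exact: gns_rep_unitary.
  rewrite /cyclic_vector -subTset -(rkcomb_dense gns_kernel); apply: closure_subset.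
  move=> _ [c _ <-]; rewrite rkcomb_orbit.
  by exists (size c), (fun i => (tnth (in_tuple c) i).1), (fun i => (tnth (in_tuple c) i).2).
move=> g; rewrite gns_rep_point mulg1.
by rewrite -[RHS]/(rkhs_inner _ _) rkpoint_inner /= invg1 mul1g.
Qed.

End GNS.

Arguments gns_rep {R G phi} phi_pd _ _.
Arguments gns_vector {R G phi} phi_pd.

Section Scalars.
Variables (R : realType) (H : hilbertType R).

Lemma scalar_bounded (c : R[i]) : bounded_operators (fun x : H => c *: x).
Proof.
split; first by move=> a x y; rewrite scalerDr !scalerA mulrC.
by move=> x; apply: cvgZl_tmp; exact: cvg_id.
Qed.

Lemma scalar_operators_center (G : groupType) (rho : G -> H -> H) :
  @scalar_operators R H `<=` vN_generated (range rho) `&` commutant (vN_generated (range rho)).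
Proof.
move=> _ [c ->]; split; (split; first exact: scalar_bounded).
  by move=> T [[Tl _] _]; apply/funext => x /=; rewrite raw_linearZ.
by move=> T [[Tl _] _]; apply/funext => x /=; rewrite raw_linearZ.
Qed.

Lemma vN_generatedE (S : set (H -> H)) T :
  S `<=` @bounded_operators R H -> S T -> vN_generated S T.
Proof.
move=> Sb ST; split; first exact: Sb.
by move=> A [_ /(_ T ST)].
Qed.

End Scalars.

Section Factor.
Variables (R : realType) (G : groupType) (phi : wreath G -> R[i]).
Local Notation C := R[i].
Hypothesis phi_pd : positive_definite phi.
Hypothesis phi1 : phi 1%g = 1.
Hypothesis central_phi : Sinf_central phi.
Hypothesis phiM : forall g g', wsupp g `&` wsupp g' = set0 ->
  phi (g * g')%g = phi g * phi g'.
Local Notation K := (gns_kernel phi_pd).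
Local Notation H := (rkhs_hilbert K).
Local Notation rho := (gns_rep phi_pd).
Local Notation xi := (gns_vector phi_pd).
Local Notation ip := (inner H).

(** This is where the centrality of [phi] enters: right translations by
    permutations preserve the kernel as well. *)
Lemma kernel_mulr (s : finperm) x y :
  K (x * (wperm G s)^-1)%g (y * (wperm G s)^-1)%g = K x y.
Proof. by rewrite /= invgM invgK -!mulgA -central_phi -!mulgA mulVg mulg1. Qed.

Definition right_shift s : H -> H := rkshift (mulgK (wperm G s)) (kernel_mulr s).

Lemma right_shift_point s x :
  right_shift s (rkpoint K x) = rkpoint K (x * (wperm G s)^-1)%g.
Proof. exact: rkshift_point. Qed.

Lemma right_shift_commutant s : commutant (range rho) (right_shift s).
Proof.
split.
  have l : linear (right_shift s) by exact: rkshift_linear.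
  split=> //; apply: contraction_continuous l _ => x.
  by rewrite (rkshift_norm _ (mulgVK _)).
move=> _ [g _ <-]; apply/funext => f; apply/val_inj/funext => x.
by rewrite /= mulgA.
Qed.

(** The operator mapping the vector of [x] to that of [s x s^-1]; it fixes
    [xi]. *)
Definition conj_op s x : H := rho (wperm G s) (right_shift s x).

Lemma conj_op_point s x : conj_op s (rkpoint K x) = rkpoint K (wconj s x).
Proof.
rewrite /conj_op right_shift_point gns_rep_point mulgA; congr rkpoint.
by rewrite /wconj; congr (_ * _)%g; apply/mulg1_eq; rewrite -wpermM mulgV.
Qed.

Lemma conj_op_linear s : linear (conj_op s).
Proof.
move=> a x y; rewrite /conj_op.
rewrite (_ : right_shift s (a *: x + y) = a *: right_shift s x + right_shift s y).
  exact: (rho_linear (gns_rep_unitary phi_pd)).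
exact: rkshift_linear.
Qed.

Lemma conj_op_inner s x y : ip (conj_op s x) (conj_op s y) = ip x y.
Proof.
rewrite (rho_inner (gns_rep_unitary phi_pd)).
exact: (rkshift_inner _ (mulgVK _)).
Qed.

(** A permutation that moves all the supports in [c] away from themselves makes
    all the cross terms factor. *)
Lemma conj_op_asymptotic (c : seq (C * wreath G)) : exists s,
  ip (conj_op s (rkcomb K c)) (rkcomb K c) =
  ip (rkcomb K c) xi * ip xi (rkcomb K c).
Proof.
have [d cd] : exists d, forall j : 'I_(size c), forall i,
    wsupp (tnth (in_tuple c) j).2 i -> (i < d)%N.
  have [f fP] := choice (fun j => wsupp_bounded (tnth (in_tuple c) j).2).
  exists (\max_j f j) => j i /fP/leq_trans; apply; exact: leq_bigmax.
(* The supports lie in the first block, of length [d.+1] to be nonempty. *)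
exists (bswap d.+1 0 1).
rewrite rkcombE big_tnth (raw_linear_sum _ _ (@conj_op_linear _)) !inner_suml mulr_suml.
apply: eq_bigr => i _; rewrite !inner_sumr mulr_sumr; apply: eq_bigr => j _.
rewrite (raw_linearZ _ _ (@conj_op_linear _)) conj_op_point.
set x := (tnth (in_tuple c) i).2; set y := (tnth (in_tuple c) j).2.
rewrite !innerZl !innerZr.
have pt u w : ip (rkpoint K u) (rkpoint K w) = phi (w^-1 * u)%g.
  exact: rkpoint_inner.
rewrite !pt invg1 mul1g mulg1.
have -> : phi (y^-1 * wconj (bswap d.+1 0 1) x)%g = phi y^-1%g * phi x.
  rewrite phiM; first by rewrite central_conj.
  apply/seteqP; split=> // k [/wsuppV/cd kd].
  have xd l : wsupp x l -> (l < d.+1)%N by move=> /cd/leqW.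
  by move=> /(wsupp_block (isT : (0 < d.+1)%N) xd); rewrite divn_small // ltnW.
ring.
Qed.

(** A central operator [T] commutes with the representation and with right
    translations by permutations, so [T xi] is fixed by all [conj_op s]. By
    [fixed_vector_line] it is a multiple of [xi], and then [T] is a scalar since
    [xi] is cyclic and [T] commutes with the representation. *)
Lemma multiplicative_factor : is_factor (vN_generated (range rho)).
Proof.
have ru := gns_rep_unitary phi_pd.
apply/seteqP; split; last exact: scalar_operators_center.
move=> T [[[Tl Tc] Tvn] [_ Tcom]].
have Trho g x : T (rho g x) = rho g (T x).
  have rM : vN_generated (range rho) (rho g).
    by apply: vN_generatedE; [move=> _ [h _ <-]; exact: rho_bounded|exists g].
  by have /(congr1 (@^~ x)) := Tcom _ rM.
have Tsh s x : T (right_shift s x) = right_shift s (T x).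
  by have /(congr1 (@^~ x)) := Tvn _ (right_shift_commutant s).
have [a Txi] : exists a : C, T xi = a *: xi.
  exists (ip (T xi) xi).
  apply: (@fixed_vector_line _ H _ _ _ (rkcomb_dense K)).
    apply/eqP; rewrite -(@eqrXn2 _ 2) // expr1n -innerxx.
    by rewrite -[ip _ _]/(rkhs_inner _ _) rkpoint_inner /= invg1 mul1g phi1.
  move=> _ [c _ <-]; have [s sE] := conj_op_asymptotic c.
  exists (conj_op s); split; [exact: conj_op_linear|exact: conj_op_inner| |exact: sE].
  rewrite /conj_op -Tsh -Trho -/(conj_op s xi) conj_op_point.
  by rewrite wconj1.
exists a; apply/funext.
apply: (@dense_eq _ H H (range (rkcomb K))) => //; first exact: rkcomb_dense.
  by case: (@scalar_bounded R H a).
move=> _ [c _ <-]; rewrite rkcomb_orbit (raw_linear_sum _ _ Tl) scaler_sumr.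
apply: eq_bigr => i _; rewrite (raw_linearZ _ _ Tl) Trho Txi.
rewrite (raw_linearZ _ _ (rho_linear ru _)) !scalerA.
by congr (_ *: _); exact: mulrC.
Qed.

Lemma multiplicative_indecomposable : indecomposable phi.
Proof.
exists H, rho, xi; split; [exact: gns_exists|exact: multiplicative_factor].
Qed.

End Factor.

(** * The three conditions are equivalent *)

Theorem proposition7 (R : realType) (Gamma : topologicalGroupType)
    (separable_Gamma : separable Gamma) (phi : wreath Gamma -> R[i])
    (state_phi : state phi) (central_phi : Sinf_central phi) :
  (indecomposable phi <->
   forall g g' : wreath Gamma, wsupp g `&` wsupp g' = set0 ->
     phi (g * g')%g = phi g * phi g') /\
  (indecomposable phi <->
   forall g : wreath Gamma,
     phi g = \big[*%R/1]_(p \in porbits_of g.1) phi (gcycle g p)).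
Proof.
have [_ phi_pd phi1] := state_phi.
have ab : indecomposable phi <->
    forall g g' : wreath Gamma, wsupp g `&` wsupp g' = set0 ->
      phi (g * g')%g = phi g * phi g'.
  split; first exact: indecomposable_multiplicative.
  exact: multiplicative_indecomposable.
by split=> //; apply: (iff_trans ab); exact: multiplicative_iff_cycle_prod.
Qed.
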